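(* Let $p$ be a real polynomial of degree $d\ge2$ with $p(0)=0$ and $p'(0)=\lambda>1$, and let $f$ be the entire solution of $f(\lambda z)=p(f(z))$ with $f(0)=0$, $f'(0)=1$. Then $$\mathcal{J}(p)\subset\mathbb{R}^-\cup\{0\}\iff\text{all zeros of }f\text{ are non-positive real},$$ and $$\mathcal{J}(p)\subset\mathbb{R}\iff\text{all zeros of }f\text{ are real}.$$
   Context: $\mathcal{J}(p)$ denotes the Julia set of $p$ (regarded as a subset of $\mathbb{C}$), and $\mathbb{R}^-$ the negative real numbers. *)

(* Defs.v *)
From mathcomp Require Import all_boot all_order all_algebra complex.
From mathcomp Require Import all_classical all_reals all_analysis.

Set Implicit Arguments.
Unset Strict Implicit.
Unset Printing Implicit Defensive.

Import Order.TTheory GRing.Theory Num.Theory.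
Import numFieldNormedType.Exports.
Import ComplexField.Normc.

Local Open Scope classical_set_scope.
Local Open Scope ring_scope.

(* Typing the complex numbers as a numClosedFieldType (rather than as the bare
   type R[i]) makes the normed topology of numFieldNormedType available. *)
Definition cplx (R : realType) : numClosedFieldType := R[i].

Definition of_real (R : realType) (x : R) : cplx R := real_complex R x.

Definition cpoly (R : realType) (p : {poly R}) : {poly cplx R} :=
  map_poly (@of_real R) p.

(* Complex differentiability: the field of scalars in [derivable] is cplx R. *)
Definition entire (R : realType) (f : cplx R -> cplx R) : Prop :=
  forall z : cplx R, derivable f z 1.

(* [Some z] is the finite point z and [None] is the point at infinity. *)
Definition riemann_sphere (R : realType) : Type :=
  one_point_compactification (cplx R).

(* Euclidean distance in R^3 between the stereographic images on the unit
   sphere. *)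
Definition chordal_dist (R : realType) (u v : riemann_sphere R) : R :=
  match u, v with
  | Some z, Some w =>
      2 * normc (z - w)
      / (Num.sqrt (1 + normc z ^+ 2) * Num.sqrt (1 + normc w ^+ 2))
  | Some z, None | None, Some z => 2 / Num.sqrt (1 + normc z ^+ 2)
  | None, None => 0
  end.

Definition compactly_cvg (R : realType) (U : set (cplx R))
    (g : nat -> cplx R -> riemann_sphere R) (h : cplx R -> riemann_sphere R) :
    Prop :=
  forall K : set (cplx R), compact K -> K `<=` U ->
  forall e : R, 0 < e ->
    \forall n \near \oo, forall z, K z -> chordal_dist (g n z) (h z) < e.

(* Normality in the sense of Montel, with respect to the chordal metric. *)
Definition normal_family (R : realType) (U : set (cplx R))
    (F : set (cplx R -> riemann_sphere R)) : Prop :=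
  forall g : nat -> cplx R -> riemann_sphere R, (forall n, F (g n)) ->
    exists phi : nat -> nat, exists h : cplx R -> riemann_sphere R,
      {homo phi : m n / (m < n)%N} /\ compactly_cvg U (g \o phi) h.

Definition iterates (R : realType) (P : {poly cplx R}) :
    set (cplx R -> riemann_sphere R) :=
  range (fun (n : nat) (z : cplx R) => Some (iter n (horner P) z)).

(* Only finite points are considered: infinity, being a superattracting fixed
   point of every polynomial of degree at least 2, never lies in the Julia
   set. *)
Definition fatou_set (R : realType) (P : {poly cplx R}) : set (cplx R) :=
  [set z | exists2 U : set (cplx R),
     open_nbhs z U & normal_family U (iterates P)].

Definition julia_set (R : realType) (P : {poly cplx R}) : set (cplx R) :=
  ~` fatou_set P.

Definition real_line (R : realType) : set (cplx R) := range (@of_real R).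

Definition neg_reals (R : realType) : set (cplx R) :=
  @of_real R @` [set x | x < 0].

Definition nonpos_reals (R : realType) : set (cplx R) :=
  @of_real R @` [set x | x <= 0].

Arguments real_line R : clear implicits.
Arguments neg_reals R : clear implicits.
Arguments nonpos_reals R : clear implicits.

(* Main.v *)
(* The zeros of [f] and the preimages of [0] under the iterates of [p] determine
   each other: [f (lambda^n z) = p^n (f z)], and [f] is tangent to the identity
   at [0].  Preimages of the repelling fixed point [0] lie in the Julia set, so a
   zero [z] of [f] is the limit of [lambda^n f (z / lambda^n)] with
   [f (z / lambda^n)] in the Julia set; this gives both direct implications.

   Conversely, every preimage [w] of [0] is a value of [f]: otherwise [f] omits
   both [w] and a preimage of [w], which a variant of Picard's little theorem
   excludes.  On a disc of radius of order [lambda^n], the polynomial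
   [w - p^n (z / lambda^n)] of degree [d^n] has no zero, so the power sums of the
   inverses of its zeros of exponent [K] are negligible as soon as
   [lambda^K > d], and its logarithmic derivative is almost a polynomial of degree
   less than [K].  Hence real zeros of [f] force real preimages of [0].  When all
   preimages lie in a real interval [S], comparing the factors of [p^n - r], for
   two preimages [r] of [0], at [z] and at the point of [S] closest to [z] shows
   that [p^n] tends to infinity locally uniformly off [S].  Finally, if the zeros
   of [f] are nonpositive but some preimage [w] of [0] is positive, then
   [0 < f < w] on the positive axis, and the strong concavity of [log p^n] and
   [log (w - p^n)] on a fixed interval gives a contradiction. *)
Require Import Defs.
From mathcomp Require Import all_boot all_order all_algebra complex ring lra.
From mathcomp Require Import all_classical all_reals all_analysis.
Set Implicit Arguments.
Unset Strict Implicit.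
Unset Printing Implicit Defensive.
Import Order.TTheory GRing.Theory Num.Theory.
Import numFieldNormedType.Exports.
Import ComplexField.Normc.
Local Open Scope classical_set_scope.
Local Open Scope ring_scope.
(** * The topology of the complex numbers through the real modulus *)

Section Topo.
Variable R : realType.
Local Notation C := (cplx R).
Local Notation N := (@normc R).
Implicit Types z w : C.

Lemma normr_normc z : `|z| = of_real (N z).
Proof. by rewrite [LHS](@normc_def R) /of_real; case: z. Qed.

Lemma normc_ge0 z : 0 <= N z. Proof. by case: z => a b; rewrite sqrtr_ge0. Qed.

Lemma lt_of_real (x y : R) : (of_real x < of_real y :> C) = (x < y).
Proof. exact: (@ltcR R). Qed.

Lemma pos_of_real (e : C) : 0 < e -> exists2 r : R, 0 < r & e = of_real r.
Proof.
case: e => a b; rewrite (@ltcE R) /= => /andP[/eqP -> h]; by exists a.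
Qed.

(** Balls of the normed structure have radii in [C], where positivity forces a real number. This
    moves the topology to the real modulus, in which all later estimates are made. *)
Lemma nbhs_normc (z : C) (U : set C) : 
  nbhs z U <-> exists2 r : R, 0 < r & forall w, N (w - z) < r -> U w.
Proof.
split.
  move/nbhs_ballP => [e /= /pos_of_real [r r0 ->] h]; exists r => // w hw.
  by apply: h; rewrite -ball_normE /= distrC normr_normc lt_of_real.
move=> [r r0 h]; apply/nbhs_ballP; exists (of_real r); first by rewrite /= lt_of_real.
move=> w; rewrite -ball_normE /= distrC normr_normc lt_of_real; exact: h.
Qed.

Lemma continuous_of_pair : continuous (fun x : R * R => (Complex x.1 x.2 : C)).
Proof.
move=> [a b] U /nbhs_normc [r r0 h].
exists (ball a (r/2), ball b (r/2)); first by split; apply: nbhsx_ballx; rewrite divr_gt0.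
move=> [x y] [/= hx hy]; apply: h.
rewrite /ball /= in hx hy.
have -> : Complex x y - Complex a b = Complex (x - a) 0 + Complex 0 (y - b) :> R[i].
  by rewrite /GRing.add /= /GRing.opp /= addr0 add0r.
apply: le_lt_trans (le_normcD _ _) _.
rewrite /= expr0n /= addr0 add0r !sqrtr_sqr distrC (distrC y).
by rewrite [r]splitr ltrD.
Qed.

Lemma Re_le_normc (z : R[i]) : `|complex.Re z| <= N z.
Proof.
case: z => a b /=; rewrite -sqrtr_sqr; apply: ler_wsqrtr.
by rewrite lerDl sqr_ge0.
Qed.
Lemma Im_le_normc (z : R[i]) : `|complex.Im z| <= N z.
Proof.
case: z => a b /=; rewrite -sqrtr_sqr; apply: ler_wsqrtr.
by rewrite lerDr sqr_ge0.
Qed.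

Definition csquare (M : R) : set C :=
  [set z : C | `|complex.Re (z : R[i])| <= M /\ `|complex.Im (z : R[i])| <= M].

Lemma compact_csquare M : compact (csquare M).
Proof.
have -> : csquare M = (fun x : R * R => (Complex x.1 x.2 : C)) @` (`[-M, M] `*` `[-M, M]).
  apply/seteqP; split => [[a b] [/= ha hb]|_ [[a b] [/= ha hb] <-]].
    by exists (a, b) => //=; rewrite !in_itv /= -!ler_norml.
  by move: ha hb; rewrite /csquare !in_itv /= -!ler_norml.
apply: continuous_compact; last by apply: compact_setX; exact: segment_compact.
exact/continuous_subspaceT/continuous_of_pair.
Qed.

Lemma compact_closed_disc (z : C) (r : R) : compact [set w : C | N (w - z) <= r].
Proof.
apply: (@subclosed_compact _ _ (csquare (N z + r))); last 2 first.
- exact: compact_csquare.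
- move=> w /= hw; have hN : N w <= N z + r.
    rewrite -[w](subrK z) addrC; apply: le_trans (le_normcD _ _) _; exact: lerD.
  by split; apply: le_trans hN; [exact: Re_le_normc|exact: Im_le_normc].
rewrite -openC openE => w /= /negP; rewrite -ltNge => hw.
apply/nbhs_normc; exists (N (w - z) - r); first by rewrite subr_gt0.
move=> v hv /= hle.
have : N (w - z) <= N (v - w) + N (v - z).
  have -> : w - z = - (v - w) + (v - z) by rewrite opprB addrA subrK.
  by rewrite -(normcN (v - w)); exact: le_normcD.
lra.
Qed.

(** Bolzano-Weierstrass in [C^K], phrased through arbitrarily late indices instead of a subsequence.
    It serves for a fixed-point iteration (one coordinate) and for normalized coefficient
    vectors. *)
Lemma bounded_cluster (K : nat) (v : nat -> 'I_K -> C) (M : R) :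
  (forall n i, N (v n i) <= M) ->
  exists l : 'I_K -> C, forall e, 0 < e -> forall n0, exists n,
    (n0 <= n)%N /\ forall i, N (v n i - l i) < e.
Proof.
move=> hv.
have cA : compact [set u : 'rV[C]_K | forall i, csquare M (u ord0 i)].
  by apply: (@rV_compact _ _ (fun=> csquare M)) => i; exact: compact_csquare.
pose u n : 'rV[C]_K := \row_i v n i.
have [|l [_ hl]] := cA (u @ \oo).
  exists 0%N => // n _ i /=; rewrite mxE; split;
  apply: le_trans (hv n i); [exact: Re_le_normc|exact: Im_le_normc].
exists (fun i => l ord0 i) => e e0 n0.
have := hl (u @` [set n | (n0 <= n)%N]) (ball l (of_real e)).
case.
- by exists n0 => // n /= hn; exists n.
- by apply: nbhsx_ballx; rewrite lt_of_real.
move=> _ [[n /= hn <-] [_ hb]]; exists n; split => // i.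
move: (hb ord0 i); rewrite /u !mxE -ball_normE /= distrC normr_normc lt_of_real; exact.
Qed.

Lemma open_disc (z : C) (r : R) : open [set w : C | N (w - z) < r].
Proof.
rewrite openE => w /= hw.
apply/nbhs_normc; exists (r - N (w - z)); first by rewrite subr_gt0.
move=> v hv /=.
have -> : v - z = (v - w) + (w - z) by rewrite addrA subrK.
by apply: le_lt_trans (le_normcD _ _) _; rewrite -ltrBrDr.
Qed.

Lemma entire_continuous (f : C -> C) : entire f -> forall (z : C) (e : R), 0 < e ->
  exists2 r : R, 0 < r & forall w, N (w - z) < r -> N (f w - f z) < e.
Proof.
move=> hf z e e0.
have cf : {for z, continuous f}.
  by apply: differentiable_continuous; apply/derivable1_diffP; exact: hf.
have /nbhs_normc [r r0 h] : nbhs z (f @^-1` [set w : C | N (w - f z) < e]).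
  apply: cf; apply/nbhs_normc; by exists e.
by exists r.
Qed.

Lemma entire_deriv0 (f : C -> C) : entire f -> f 0 = 0 -> derive1 f 0 = 1 ->
  forall e : R, 0 < e ->
  exists2 r : R, 0 < r & forall w, N w < r -> N (f w - w) <= e * N w.
Proof.
move=> hf f0 f1 e e0.
have /cvg_ex [l hl] : cvg ((fun h => h^-1 *: (f (h *: 1 + 0) - f 0)) @ (0 : C)^') := hf 0.
have hl1 : l = 1.
  by rewrite -f1 derive1E /derive; apply/esym/cvg_lim.
subst l.
have : nbhs (1 : C) [set w : C | N (w - 1) < e] by apply/nbhs_normc; exists e.
move=> /hl; rewrite /= /nbhs /= /dnbhs /within => /nbhs_normc [r r0 h].
exists r => // w hw; have [->|w0] := eqVneq w 0; first by rewrite f0 subr0 normc0 mulr0.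
have := h w; rewrite subr0 => /(_ hw w0) /=.
rewrite /GRing.scale /= mulr1 addr0 f0 subr0 => h1.
have -> : f w - w = (w^-1 * f w - 1) * w by rewrite mulrBl mulrAC mulVf// mul1r mul1r.
by rewrite normcM ler_wpM2r ?normc_ge0// ltW.
Qed.

End Topo.
(** * Polynomial estimates *)

Section Cauchy.
Variable R : realType.
Local Notation C := (cplx R).
Local Notation N := (@normc R).

Lemma normcX (z : C) n : N (z ^+ n) = N z ^+ n.
Proof. by elim: n => [|n IH]; rewrite ?expr0 ?normc1 // !exprS normcM IH. Qed.

Lemma normc_of_real (x : R) : N (of_real x) = `|x|.
Proof. by rewrite /of_real /= expr0n addr0 sqrtr_sqr. Qed.

Lemma normc_nat n : N n%:R = n%:R.
Proof. by rewrite -[RHS]normr_nat -normc_of_real /of_real rmorph_nat. Qed.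

Lemma normc_leB (u v : C) : N (u - v) <= N u + N v.
Proof. by rewrite -(normcN v); exact: le_normcD. Qed.

Lemma normc_distC (u v : C) : N (u - v) = N (v - u).
Proof. by rewrite -normcN opprB. Qed.

Lemma normc_le_dist (u v : C) : N u <= N (u - v) + N v.
Proof. by rewrite -{1}[u](subrK v); exact: le_normcD. Qed.

Lemma expr_unbounded (x M : R) : 1 < x -> exists n0, forall n, (n0 <= n)%N -> M < x ^+ n.
Proof.
move=> x1.
have bern n : 1 + n%:R * (x - 1) <= x ^+ n.
  elim: n => [|n IH]; first by rewrite mul0r addr0 expr0.
  rewrite exprS -natr1; 
  have ny : 0 <= n%:R * (x - 1) ^+ 2 by rewrite mulr_ge0 ?ler0n ?sqr_ge0.
  have : x * (1 + n%:R * (x - 1)) <= x * x ^+ n by rewrite ler_wpM2l//; lra.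
  nra.
exists (Num.bound `|M / (x - 1)|) => n hn.
apply: lt_le_trans (bern n).
have : M / (x - 1) < n%:R.
  apply: le_lt_trans (ler_norm _) _; apply: lt_le_trans (archi_boundP (normr_ge0 _)) _.
  by rewrite ler_nat.
rewrite ltr_pdivrMr; lra.
Qed.

(* Splitting [Q] into even and odd parts replaces averaging over roots of unity:
   both parts inherit a bound on the circle of radius [r ^+ 2]. *)
Lemma cauchy_coef (Q : {poly C}) (r M : R) (q : nat) : 0 < r ->
  (forall z : C, N z = r -> N Q.[z] <= M) -> N Q`_q * r ^+ q <= M.
Proof.
have [n] := ubnP (size Q); elim: n => // n IH in Q r M q *; rewrite ltnS => sQ r0 hQ.
have M0 : 0 <= M.
  apply: le_trans (hQ (of_real r) _); first exact: normc_ge0.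
  by rewrite normc_of_real ger0_norm ?ltW.
have [s1|s1] := leqP (size Q) 1.
  have [c Qc] : exists c, Q = c%:P by exists Q`_0; exact: size1_polyC.
  case: q => [|q]; last by rewrite nth_default ?(leq_trans s1)// normc0 mul0r.
  rewrite expr0 mulr1; have := hQ (of_real r); rewrite Qc hornerC coefC eqxx.
  by apply; rewrite normc_of_real ger0_norm ?ltW.
(* Both square roots [s] and [- s] of [z] lie on the circle of radius [r]; the sum and difference of
   the values there isolate the even and odd parts. *)
have key (z : C) : N z = r ^+ 2 -> exists s : C, [/\ N s = r, s ^+ 2 = z,
    Q.[s] = (even_poly Q).[z] + (odd_poly Q).[z] * s &
    Q.[- s] = (even_poly Q).[z] - (odd_poly Q).[z] * s].
  move=> hz; have hs : (sqrtc z : C) ^+ 2 = z by exact: sqr_sqrtc.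
  exists (sqrtc z : C); split => //.
  - move: hz; rewrite -{1}hs normcX => /eqP.
    by rewrite eqrXn2 ?normc_ge0 ?ltW// => /eqP.
  - by rewrite -{1}(poly_even_odd Q) hornerD hornerM !horner_comp !hornerXn hornerX hs.
  - by rewrite -{1}(poly_even_odd Q) hornerD hornerM !horner_comp !hornerXn hornerX sqrrN hs mulrN.
have N2 (x : C) : N (2 * x) = 2 * N x by rewrite normcM normc_nat.
have NN (s : C) : N s = r -> N Q.[s] <= M /\ N Q.[- s] <= M.
  by move=> hs; split; apply: hQ; rewrite ?normcN.
have r2 : 0 < r ^+ 2 by rewrite exprn_gt0.
have szu : (uphalf (size Q) < size Q)%N.
  case: (size Q) s1 => [|[|k]] // _; rewrite [uphalf _]/= !ltnS.
  by rewrite leq_uphalf_double -addnn leq_addr.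
have [b qb] : exists b : bool, q = (b + q./2.*2)%N by exists (odd q); rewrite odd_double_half.
rewrite qb; case: b qb => qb.
- have := IH (odd_poly Q) (r ^+ 2) (M / r) q./2.
  rewrite coef_odd_poly -muln2 add1n.
  move=> /(_ _ r2) h.
  suff h' : N Q`_(q./2 * 2).+1 * r ^+ 2 ^+ q./2 <= M / r.
    by rewrite exprSr mulrA -ler_pdivlMr// [in X in r ^+ X]mulnC exprM.
  apply: h.
    apply: leq_ltn_trans (size_odd_poly _) _; apply: leq_trans sQ.
    by apply: leq_ltn_trans szu; rewrite uphalf_half leq_addl.
  move=> z /key [s [hs _ h1 h2]]; have [n1 n2] := NN s hs.
  rewrite ler_pdivlMr// -hs -normcM.
  have : N (2 * ((odd_poly Q).[z] * s)) <= N Q.[s] + N Q.[- s].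
    rewrite -(normcN Q.[- s]); apply: le_trans (le_normcD _ _).
    by rewrite h1 h2 le_eqVlt; apply/orP; left; apply/eqP; congr N; ring.
  rewrite N2; lra.
- have := IH (even_poly Q) (r ^+ 2) M q./2.
  rewrite coef_even_poly -muln2 add0n.
  move=> /(_ _ r2) h.
  rewrite [in X in r ^+ X]mulnC exprM; apply: h.
    by apply: leq_ltn_trans (size_even_poly _) _; rewrite (leq_trans szu).
  move=> z /key [s [hs _ h1 h2]]; have [n1 n2] := NN s hs.
  have : N (2 * (even_poly Q).[z]) <= N Q.[s] + N Q.[- s].
    apply: le_trans (le_normcD _ _).
    by rewrite h1 h2 le_eqVlt; apply/orP; left; apply/eqP; congr N; ring.
  rewrite N2; lra.
Qed.

Lemma horner_lipschitz (Q : {poly C}) (M : R) : 0 <= M ->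
  exists2 L : R, 0 <= L & forall a b, N a <= M -> N b <= M ->
    N (Q.[a] - Q.[b]) <= L * N (a - b).
Proof.
move=> M0; elim/poly_ind: Q => [|Q c [L L0 IH]].
  by exists 0 => // a b _ _; rewrite !horner0 subr0 normc0 mul0r.
have Q0 := normc_ge0 Q.[0].
exists (N Q.[0] + L * M + L * M) => [|a b ha hb].
  by rewrite !addr_ge0// mulr_ge0.
rewrite !hornerMXaddC.
have -> : Q.[a] * a + c - (Q.[b] * b + c) = Q.[a] * (a - b) + (Q.[a] - Q.[b]) * b by ring.
have d0 := normc_ge0 (a - b).
apply: le_trans (le_normcD _ _) _; rewrite !normcM [leRHS]mulrDl; apply: lerD.
  apply: ler_wpM2r => //; apply: le_trans (normc_le_dist _ Q.[0]) _.
  rewrite addrC lerD2l; apply: le_trans (IH a 0 _ _) _ => //; first by rewrite normc0.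
  by rewrite subr0 ler_wpM2l.
rewrite mulrAC; apply: ler_pM => //; [exact: normc_ge0|exact: normc_ge0|exact: IH].
Qed.

(** With [P = Q * 'X + c], the left side is [(Q a - Q 0) (a - b) + b (Q a - Q b)], and the Lipschitz
    bound for [Q] on the unit disc produces the factor [t] in each term. *)
Lemma horner_quadratic (P : {poly C}) :
  exists2 B : R, 0 <= B & forall t a b, t <= 1 -> N a <= t -> N b <= t ->
    N (P.[a] - P.[b] - P^`().[0] * (a - b)) <= B * t * N (a - b).
Proof.
elim/poly_ind: P => [|Q c _].
  by exists 0 => // t a b _ _ _; rewrite deriv0 !horner0 subrr mul0r subrr normc0 !mul0r.
have [L L0 hL] := horner_lipschitz Q ler01.
exists (L + L) => [|t a b t1 ha hb]; first exact: addr_ge0.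
rewrite !hornerMXaddC derivD derivM derivX derivC addr0 mulr1 hornerD hornerM hornerX mulr0 add0r.
have -> : Q.[a] * a + c - (Q.[b] * b + c) - Q.[0] * (a - b) =
  (Q.[a] - Q.[0]) * (a - b) + b * (Q.[a] - Q.[b]) by ring.
have d0 := normc_ge0 (a - b).
have a1 := le_trans ha t1; have b1 := le_trans hb t1.
apply: le_trans (le_normcD _ _) _; rewrite !normcM mulrDl [leRHS]mulrDl; apply: lerD.
  apply: ler_wpM2r => //; apply: le_trans (hL a 0 _ _) _ => //; first by rewrite normc0 ler01.
  by rewrite subr0 ler_wpM2l.
by rewrite (mulrC L) -mulrA; apply: ler_pM => //; [exact: normc_ge0|exact: normc_ge0|exact: hL].
Qed.

Lemma horner_continuous (Q : {poly C}) (a : C) (e : R) : 0 < e ->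
  exists2 r, 0 < r & forall b, N (b - a) < r -> N (Q.[b] - Q.[a]) < e.
Proof.
move=> e0; have a0 := normc_ge0 a; have a1 : 0 <= N a + 1 by lra.
have [L L0 hL] := horner_lipschitz Q a1.
exists (Num.min 1 (e / (L + 1))).
  by rewrite lt_min ltr01 divr_gt0//; lra.
move=> b; rewrite lt_min => /andP[b1 be].
have := normc_le_dist b a => ba.
apply: le_lt_trans (hL b a _ _) _; [lra|lra|].
move: be; rewrite ltr_pdivlMr; last lra.
have := normc_ge0 (b - a); nra.
Qed.

End Cauchy.

(** Keeping the iterates as polynomials gives access to their degree, roots, coefficients and
    derivative. *)
Fixpoint poly_iter (K : comNzRingType) (P : {poly K}) (n : nat) : {poly K} :=
  if n is m.+1 then P \Po poly_iter P m else 'X.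

(** * Preimages of the repelling fixed point lie in the Julia set *)

Section PolyIter.
Variable K : idomainType.
Variable P : {poly K}.
Local Notation pit := (poly_iter P).

Lemma horner_poly_iter n z : (pit n).[z] = iter n (horner P) z.
Proof. by elim: n => [|n IH] /=; rewrite ?hornerX// horner_comp IH. Qed.

Lemma iter_fixed0 n : P.[0] = 0 -> iter n (horner P) 0 = 0.
Proof. by move=> P0; elim: n => //= n ->. Qed.

Lemma size_poly_iter n : (size (pit n)).-1 = ((size P).-1 ^ n)%N.
Proof.
elim: n => [|n IH] /=; first by rewrite size_polyX.
by rewrite size_comp_poly IH expnS.
Qed.

Lemma deriv_poly_iter0 n : P.[0] = 0 -> (pit n)^`().[0] = P^`().[0] ^+ n.
Proof.
move=> P0; elim: n => [|n IH] /=; first by rewrite derivX hornerC expr0.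
by rewrite deriv_comp hornerM IH horner_comp horner_poly_iter iter_fixed0// exprS.
Qed.

Lemma poly_iter_factor n : P.[0] = 0 ->
  exists2 B : {poly K}, pit n = B * 'X & B.[0] = P^`().[0] ^+ n.
Proof.
move=> P0; have : root (pit n) 0 by rewrite rootE horner_poly_iter iter_fixed0.
move/factor_theorem => [B]; rewrite subr0 => hB; exists B => //.
by rewrite -deriv_poly_iter0// hB derivM derivX mulr1 hornerD hornerM hornerX mulr0 add0r.
Qed.

End PolyIter.

(** * Chordal estimates and failure of normality *)

Section Fatou.
Variable R : realType.
Local Notation C := (cplx R).
Local Notation N := (@normc R).

Lemma sqrt1D_ge1 (x : R) : 1 <= Num.sqrt (1 + x ^+ 2).
Proof. by rewrite -[leLHS]sqrtr1 ler_wsqrtr// lerDl sqr_ge0. Qed.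

Lemma sqrt1D_le (x : R) : 0 <= x -> Num.sqrt (1 + x ^+ 2) <= 1 + x.
Proof.
move=> x0; rewrite -[leRHS]ger0_norm; last lra.
rewrite -sqrtr_sqr ler_wsqrtr//; nra.
Qed.

Lemma chordal_sym (u v : riemann_sphere R) : chordal_dist u v = chordal_dist v u.
Proof.
case: u v => [z|] [w|] //=; congr (_ * _ / _); last by rewrite mulrC.
by rewrite -normcN opprB.
Qed.

(** Infinity is at chordal distance at least [2 / (1 + M)] from [u], so [x] is finite. Clearing the
    square roots gives [2 |u - v| < 1 + |v|], and the triangle inequality concludes. *)
Lemma chordal_bound (u : C) (x : riemann_sphere R) (e M : R) :
  0 < e -> N u <= M -> e * (1 + M) <= 1 ->
  chordal_dist (Some u) x < e -> exists2 v : C, x = Some v & N v <= 2 * M + 1.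
Proof.
move=> e0 uM eM; have u0 := normc_ge0 u; have su := sqrt1D_le u0.
have su1 := sqrt1D_ge1 (N u).
case: x => [v|] /=; last first.
  rewrite ltr_pdivrMr; last lra.
  move=> h; exfalso; nra.
have v0 := normc_ge0 v; have sv := sqrt1D_le v0; have sv1 := sqrt1D_ge1 (N v).
rewrite ltr_pdivrMr; last by rewrite mulr_gt0; lra.
move=> h; exists v => //.
have := normc_le_dist v u; rewrite normc_distC => vu.
set a := Num.sqrt _ in su su1 h *; set b := Num.sqrt _ in sv sv1 h *.
have h1 : a * b <= (1 + M) * (1 + N v) by apply: ler_pM; lra.
have h2 : e * (a * b) <= e * ((1 + M) * (1 + N v)) by rewrite ler_pM2l.
have h3 : e * (1 + M) * (1 + N v) <= 1 * (1 + N v) by rewrite ler_wpM2r//; lra.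
lra.
Qed.

(* If the iterates were bounded near [w] along a subsequence, so would be their
   coefficients at [w]; but the first nonzero one is multiplied by [P'(0)] at
   each step beyond the [n]-th. *)
Lemma preimage0_julia (P : {poly C}) (w : C) (n : nat) :
  P.[0] = 0 -> 1 < N P^`().[0] -> iter n (horner P) w = 0 -> julia_set P w.
Proof.
move=> P0 P1 wn [U [oU Uw] nU].
pose g k z : riemann_sphere R := Some (iter k (horner P) z).
have [phi [h [phi_incr hcv]]] := nU g (fun k => ex_intro2 _ _ k I erefl).
have [r r0 rU] : exists2 r : R, 0 < r & forall v, N (v - w) < r -> U v.
  by apply/nbhs_normc; exact: open_nbhs_nbhs.
pose rr := r / 2; have rr0 : 0 < rr by rewrite divr_gt0.
have hKU : [set v : C | N (v - w) <= rr] `<=` U.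
  by move=> v /= hv; apply: rU; apply: le_lt_trans hv _; rewrite /rr; lra.
(* [chordal_bound] is applied twice, from an iterate to the limit and back to another iterate, so
   the bound goes from 1 to 3 to 7; [1 / 8] is small enough for both. *)
have e0 : 0 < 1 / 8 :> R by lra.
have [k0 _ hk0] := hcv _ (@compact_closed_disc R w rr) hKU _ e0.
have phi_ge k : (k <= phi k)%N.
  by elim: k => // k IH; apply: leq_ltn_trans IH (phi_incr _ _ _).
have it0 k : (n <= k)%N -> iter k (horner P) w = 0.
  by move=> /subnK <-; rewrite iterD wn iter_fixed0.
(* The iterate of index [phi k1] vanishes at [w], hence is small near [w]; all later ones are
   compared with it through the limit [h]. *)
pose k1 := maxn k0 n.
have [s s0 hs] : exists2 s : R, 0 < s &
    forall v, N (v - w) < s -> N (iter (phi k1) (horner P) v) < 1.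
  have [s s0 hs] := horner_continuous (poly_iter P (phi k1)) w (@ltr01 R).
  exists s => // v /hs; rewrite !horner_poly_iter (it0 (phi k1)) ?subr0//.
  by rewrite (leq_trans _ (phi_ge _))// leq_maxr.
pose t := Num.min rr s / 2; have t0 : 0 < t by rewrite divr_gt0// lt_min rr0.
have trr : t <= rr by rewrite /t; case: (lerP rr s) => ?; lra.
have ts : t < s by rewrite /t; case: (lerP rr s) => ?; lra.
have bound k v : (k0 <= k)%N -> N (v - w) <= t -> N (iter (phi k) (horner P) v) <= 7.
  move=> hk hv.
  have hvr : N (v - w) <= rr by exact: le_trans trr.
  have c1 := hk0 k1 (leq_maxl _ _) v hvr; have c2 := hk0 k hk v hvr.
  have l1 : N (iter (phi k1) (horner P) v) <= 1 by apply/ltW/hs/(le_lt_trans hv).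
  have [|x hx xle] := chordal_bound e0 l1 _ c1; first lra.
  rewrite chordal_sym hx in c2.
  have [|y [<-] yle] := chordal_bound e0 xle _ c2; lra.
pose Q := poly_iter P n \Po ('X + w%:P).
have Q0 : Q.[0] = 0 by rewrite horner_comp hornerD hornerX hornerC add0r horner_poly_iter.
have Qnz : Q != 0.
  apply/negP => /eqP Qz; have : (poly_iter P n)^`().[0] != 0.
    rewrite deriv_poly_iter0// expf_neq0//; apply/negP => /eqP h0.
    by move: P1; rewrite h0 normc0 ltr10.
  apply/negP; rewrite negbK.
  have -> : poly_iter P n = Q \Po ('X - w%:P).
    by rewrite /Q -comp_polyA comp_polyD comp_polyX comp_polyC subrK comp_polyXr.
  by rewrite Qz comp_poly0 deriv0 horner0.
have [q [A A0 QA]] : exists q, exists2 A : {poly C}, A.[0] != 0 & Q = A * 'X ^+ q.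
  have [q [A]] := multiplicity_XsubC Q 0; rewrite Qnz subr0 /= => hA ->.
  by exists q, A.
(* [Q] is the [n]-th iterate expanded at [w]. Since [P^m] is ['X] times a factor with value
   [P'(0)^m] at [0], composing with [A * 'X ^+ q] multiplies the lowest coefficient by that
   value. *)
have coefk m : ((poly_iter P m \Po Q)`_q) = A.[0] * P^`().[0] ^+ m.
  have [B -> <-] := poly_iter_factor m P0.
  rewrite comp_polyM comp_polyX {2}QA mulrA coefMXn ltnn subnn.
  by rewrite -horner_coef0 hornerM horner_comp Q0 mulrC.
have cb k : (k1 <= k)%N -> N A.[0] * N P^`().[0] ^+ (phi k - n) * t ^+ q <= 7.
  rewrite geq_max => /andP[kk0 kn].
  rewrite -normcX -normcM -coefk; apply: cauchy_coef => // z hz.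
  rewrite horner_comp !horner_poly_iter horner_comp horner_poly_iter.
  rewrite -iterD subnK ?(leq_trans kn)// hornerD hornerX hornerC.
  by apply: bound => //; rewrite addrK hz.
have Atq : 0 < N A.[0] * t ^+ q.
  rewrite mulr_gt0 ?exprn_gt0// lt_neqAle normc_ge0 andbT eq_sym.
  by apply: contra A0 => /eqP/eq0_normc ->.
have [m0 hm0] := expr_unbounded (7 / (N A.[0] * t ^+ q)) P1.
have := cb (maxn k1 (m0 + n)) (leq_maxl _ _); apply/negP; rewrite -ltNge.
rewrite mulrAC -ltr_pdivrMl// mulrC; apply: hm0.
by rewrite leq_subRL ?(leq_trans _ (phi_ge _)) ?leq_max// addnC leqnn ?orbT// leq_addl orbT.
Qed.
End Fatou.

(** * Confining the Julia set to a real interval *)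

Section Escape.
Variable R : realType.
Local Notation C := (cplx R).
Local Notation N := (@normc R).

(** After factoring [Q] over its roots, each linear factor gains the ratio [k]. *)
Lemma horner_roots_ge (Q : {poly C}) (k : R) (w x : C) : 0 <= k ->
  (forall s, root Q s -> k * N (x - s) <= N (w - s)) ->
  k ^+ (size Q).-1 * N Q.[x] <= N Q.[w].
Proof.
move=> k0 hk; have [->|Q0] := eqVneq Q 0.
  by rewrite !horner0 normc0 mulr0.
have [rs Qrs] := closed_field_poly_normal Q.
have lc : lead_coef Q != 0 by rewrite lead_coef_eq0.
have -> : (size Q).-1 = size rs.
  by rewrite Qrs size_scale// size_prod_XsubC.
have : forall s, s \in rs -> k * N (x - s) <= N (w - s).
  by move=> s hs; apply: hk; rewrite Qrs rootZ// root_prod_XsubC.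
rewrite Qrs !hornerZ !normcM mulrCA => h; apply: ler_wpM2l; first exact: normc_ge0.
elim: rs h {Qrs hk} => [|s rs IH] h.
  by rewrite !big_nil !hornerC expr0 mul1r.
rewrite !big_cons !hornerM !hornerXsubC !normcM exprS mulrACA.
apply: ler_pM; rewrite ?mulr_ge0 ?exprn_ge0 ?normc_ge0//; first by apply: h; rewrite mem_head.
by apply: IH => u hu; apply: h; rewrite inE hu orbT.
Qed.

Lemma sqr_normcE (z : R[i]) : N z ^+ 2 = complex.Re z ^+ 2 + complex.Im z ^+ 2.
Proof. by case: z => a b /=; rewrite sqr_sqrtr// addr_ge0 ?sqr_ge0. Qed.

(** For [x] the nearest point of the interval, the angle at [x] between [z] and [s] is not acute, so
    Pythagoras survives as an inequality. *)
Lemma interval_projection (a b : R) (z : C) : a <= b ->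
  exists2 x, a <= x <= b & forall s, a <= s <= b ->
    N (z - of_real x) ^+ 2 + (x - s) ^+ 2 <= N (z - of_real s) ^+ 2.
Proof.
case: z => u v ab.
have E (t : R) : N (Complex u v - of_real t) ^+ 2 = (u - t) ^+ 2 + v ^+ 2.
  by rewrite sqr_normcE /= oppr0 addr0.
have [ua|au] := lerP u a.
  exists a; first by rewrite lexx ab.
  by move=> s /andP[sa sb]; rewrite !E; nra.
have [ub|bu] := lerP u b.
  exists u; first by rewrite (ltW au) ub.
  by move=> s /andP[sa sb]; rewrite !E; nra.
exists b; first by rewrite lexx ab.
by move=> s /andP[sa sb]; rewrite !E; nra.
Qed.

Lemma chordal_infty (v : C) (e : R) : 0 < e -> 2 / e < N v ->
  chordal_dist (Some v) None < e.
Proof.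
move=> e0; rewrite ltr_pdivrMr// => h /=.
have v0 := normc_ge0 v.
have : N v <= Num.sqrt (1 + N v ^+ 2).
  rewrite -[leLHS]ger0_norm// -sqrtr_sqr ler_wsqrtr//; lra.
have := sqrt1D_ge1 (N v).
move=> h1 h2; rewrite ltr_pdivrMr; nra.
Qed.

(** In a sequence of iterates, either some index occurs infinitely often and gives a constant
    subsequence, or the indices tend to infinity and the whole sequence converges to the point at
    infinity. *)
Lemma escaping_fatou (P : {poly C}) (z : C) (rho : R) : 0 < rho ->
  (forall M : R, exists n0, forall n w, (n0 <= n)%N -> N (w - z) < rho ->
    M < N (iter n (horner P) w)) ->
  fatou_set P z.
Proof.
move=> rho0 hesc.
exists [set w : C | N (w - z) < rho].
  by split; [exact: open_disc|rewrite /= subrr normc0].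
move=> g hg.
have /choice [m hm] : forall k, exists n : nat, g k = fun v => Some (iter n (horner P) v).
  by move=> k; have [n _ <-] := hg k; exists n.
have [[c hc]|hc] := pselect (exists c : nat, forall k0, exists k, (k0 < k)%N /\ m k = c).
- have [nxt hnxt] := choice hc.
  pose phi := fix phi n := if n is n'.+1 then nxt (phi n') else nxt 0%N.
  exists phi, (fun v => Some (iter c (horner P) v)); split.
    by apply: homo_ltn => [|k /=]; [exact: ltn_trans|have [] := hnxt (phi k)].
  move=> K _ _ e e0; exists 0%N => // k _ v _.
  have mk : m (phi k) = c by case: k => [|k] /=; [have [] := hnxt 0%N|have [] := hnxt (phi k)].
  by rewrite /= hm mk /= subrr normc0 mulr0 mul0r.
- exists id, (fun=> None); split => // K _ KU e e0.
  have minf c : exists k0, forall k, (k0 <= k)%N -> (c <= m k)%N.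
    elim: c => [|c [k0 hk0]]; first by exists 0%N.
    have [k1 hk1] : exists k1, forall k, (k1 < k)%N -> m k <> c.
      have := hc; rewrite -forallNE => /(_ c) /existsNP [k1 hk1]; exists k1 => k kk mk.
      by apply: hk1; exists k.
    exists (maxn k0 k1.+1) => k; rewrite geq_max => /andP[/hk0 ck /hk1 /eqP mk].
    by rewrite ltn_neqAle eq_sym mk.
  have [n0 hn0] := hesc (2 / e); have [k0 hk0] := minf n0.
  exists k0 => // k /= kk v /KU /= hv.
  by rewrite /= hm; apply: chordal_infty => //; apply: hn0 => //; exact: hk0.
Qed.

Lemma real_preimages_fatou (P : {poly C}) (a b : R) (r1 r2 : C) :
  (2 < size P)%N -> r1 != r2 -> a <= b ->
  (forall n w, iter n (horner P) w = r1 \/ iter n (horner P) w = r2 ->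
     exists2 x, a <= x <= b & w = of_real x) ->
  forall z, ~ (exists2 x, a <= x <= b & z = of_real x) -> fatou_set P z.
Proof.
move=> sP r12 ab hpre z hz.
have [x0 x0ab hx0] := interval_projection z ab.
pose rho := N (z - of_real x0) / 2.
have rho0 : 0 < rho.
  rewrite divr_gt0// lt_neqAle normc_ge0 andbT eq_sym; apply/eqP => /eq0_normc /eqP.
  by rewrite subr_eq0 => /eqP zx; apply: hz; exists x0.
(* Points of the interval are at most [L] apart, and the summand 1 covers [a = b]. With [w] at least
   [rho] away, [k] is the resulting lower bound for the ratio of distances to a root from [w] and
   from its projection. *)
pose L := b - a + 1; have L0 : 0 < L by rewrite /L; lra.
pose k := Num.sqrt (1 + (rho / L) ^+ 2).
have q0 : 0 < (rho / L) ^+ 2 by rewrite exprn_gt0// divr_gt0.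
have k2 : k ^+ 2 = 1 + (rho / L) ^+ 2 by rewrite sqr_sqrtr//; lra.
have k1 : 1 < k by rewrite -[ltLHS]sqrtr1 ltr_sqrt; lra.
apply: (@escaping_fatou _ _ rho) => // M.
have r12p : 0 < N (r1 - r2).
  rewrite lt_neqAle normc_ge0 andbT eq_sym; apply: contra r12 => /eqP/eq0_normc/eqP.
  by rewrite subr_eq0.
(* Adding the estimates for [r1] and [r2] bounds [k ^+ n * N (r1 - r2)] by
   [2 * N (P^n w) + N r1 + N r2], whence this threshold. *)
have [n0 hn0] := expr_unbounded (2 * (M + N r1 + N r2) / N (r1 - r2)) k1.
exists n0 => n w nn wz.
have [x xab hx] := interval_projection w ab.
have wrho s : a <= s <= b -> rho <= N (w - of_real s).
  move=> hs; have : N (z - of_real x0) <= N (z - of_real s).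
    rewrite -ler_sqr ?nnegrE ?normc_ge0//; apply: le_trans (hx0 s hs).
    by rewrite lerDl sqr_ge0.
  have := normc_le_dist (z - of_real s) (w - of_real s).
  have -> : z - of_real s - (w - of_real s) = z - w by ring.
  rewrite (normc_distC z w) => h1 h2; move: wz h1 h2; rewrite /rho; lra.
have hroot s : a <= s <= b -> k * N (of_real x - of_real s) <= N (w - of_real s).
  move=> hs; rewrite -ler_sqr ?nnegrE ?mulr_ge0 ?normc_ge0// ?(ltW (lt_trans ltr01 k1))//.
  apply: le_trans (hx s hs).
  rewrite exprMn k2 -[of_real x - _](@rmorphB _ _ (real_complex R)) normc_of_real.
  rewrite real_normK ?num_real// mulrDl mul1r addrC lerD2r.
  apply: le_trans (_ : rho ^+ 2 <= _); last first.
    by rewrite ler_sqr ?nnegrE ?normc_ge0 ?(ltW rho0)//; apply: wrho.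
  rewrite expr_div_n mulrAC ler_pdivrMr ?exprn_gt0// ler_wpM2l ?sqr_ge0//.
  rewrite -[leLHS]real_normK ?num_real// ler_sqr ?nnegrE ?normr_ge0 ?(ltW L0)// /L.
  move: hs xab => /andP[sa sb] /andP[xa xb]; rewrite ler_norml; apply/andP; split; lra.
pose Q := poly_iter P n.
have sQ : (n < (size Q).-1)%N.
  by rewrite size_poly_iter; apply: ltn_expl; move: sP; case: (size P) => [|[]].
have key r : r = r1 \/ r = r2 -> k ^+ n * N (Q.[of_real x] - r) <= N (Q.[w] - r).
  move=> hr.
  have := @horner_roots_ge (Q - r%:P) k w (of_real x).
  rewrite !hornerD !hornerN !hornerC => h.
  apply: le_trans (h (ltW (lt_trans ltr01 k1)) _); last first.
    move=> s; rewrite rootE !hornerE subr_eq0 horner_poly_iter => /eqP hs.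
    have [|t htab ->] := hpre n s; last exact: hroot.
    by rewrite hs.
  apply: ler_wpM2r; first exact: normc_ge0.
  rewrite size_polyDl; last first.
    rewrite size_polyN; apply: leq_ltn_trans (size_polyC_leq1 _) _.
    by move: sQ; case: (size Q) => [|[]].
  by apply: ler_weXn2l; [exact: ltW|exact: ltnW].
have kn := hn0 n nn; rewrite ltr_pdivrMr// in kn.
have k1' := key r1 (or_introl erefl); have k2' := key r2 (or_intror erefl).
rewrite -horner_poly_iter -/Q.
have t1 := normc_leB Q.[w] r1; have t2 := normc_leB Q.[w] r2.
have : N (r1 - r2) <= N (Q.[of_real x] - r1) + N (Q.[of_real x] - r2).
  have -> : r1 - r2 = - ((Q.[of_real x] - r1) - (Q.[of_real x] - r2)) by ring.
  by rewrite normcN; exact: normc_leB.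
have kn0 : 0 < k ^+ n by rewrite exprn_gt0//; lra.
rewrite -(ler_pM2l kn0) mulrDr.
have := normc_ge0 r1; have := normc_ge0 r2; lra.
Qed.

End Escape.

(** * Linearization at the fixed point *)

Section Koenigs.
Variables (R : realType) (P : {poly cplx R}) (lambda : R) (f : cplx R -> cplx R).
Local Notation C := (cplx R).
Local Notation N := (@normc R).
Local Notation L := (of_real lambda).
Hypothesis lambda1 : 1 < lambda.
Hypothesis P0 : P.[0] = 0.
Hypothesis P1 : P^`().[0] = L.
Hypothesis hf : entire f.
Hypothesis hfP : forall z, f (L * z) = P.[f z].
Hypothesis f0 : f 0 = 0.
Hypothesis f1 : derive1 f 0 = 1.

Let lambda0 : 0 < lambda. Proof. exact: lt_trans ltr01 lambda1. Qed.

Lemma normc_multiplier_expn n : N (L ^+ n) = lambda ^+ n.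
Proof. by rewrite normcX normc_of_real gtr0_norm. Qed.

Lemma multiplier_expn_neq0 n : L ^+ n != 0.
Proof.
by apply: expf_neq0; rewrite -[0]/(of_real 0) (inj_eq (@complexI R)) gt_eqF.
Qed.

Lemma poincare_iter n z : f (L ^+ n * z) = iter n (horner P) (f z).
Proof.
by elim: n => [|n IH]; rewrite ?expr0 ?mul1r//= exprS -mulrA hfP IH.
Qed.

(* The factor [D * t], rather than a constant, is what makes the induction close. *)
Lemma iter_linear_near0 : exists2 D : R, 1 <= D & forall n t a b, 0 <= t -> D * t <= 1 / 2 ->
  N a <= t / lambda ^+ n -> N b <= t / lambda ^+ n ->
  N (iter n (horner P) a - iter n (horner P) b - L ^+ n * (a - b))
    <= D * t * (lambda ^+ n * N (a - b)).
Proof.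
have l1 := lambda1; have l0 := lambda0.
have [B B0 hB] := horner_quadratic P; rewrite P1 in hB.
(* One more application of [P] costs a quadratic error [4 * B * t'] relative to
   [lambda ^+ n * N (a - b)]. The gain from [t'] to [t = lambda * t'] absorbs it as soon as
   [4 * B <= D * (lambda - 1)]. *)
pose D := 4 * B / (lambda - 1) + 1.
have D1 : 1 <= D by rewrite lerDr divr_ge0 ?mulr_ge0//; lra.
have DB : 4 * B <= D * (lambda - 1).
  have -> : D * (lambda - 1) = 4 * B + (lambda - 1) by rewrite /D; field; lra.
  lra.
exists D => //; elim => [|n IH] t a b t0 tD ha hb.
  by rewrite expr0 mul1r subrr normc0 mulr_ge0 ?mulr_ge0 ?expr0 ?mul1r ?normc_ge0//; lra.
pose t' := t / lambda.
have tt : t = lambda * t' by rewrite /t'; field; lra.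
have t'0 : 0 <= t' by rewrite divr_ge0//; lra.
have t't : t' <= t by rewrite tt; nra.
have t'D : D * t' <= 1 / 2 by nra.
have tn : t / lambda ^+ n.+1 = t' / lambda ^+ n by rewrite exprS invfM mulrA.
rewrite tn in ha hb.
have ln0 : 0 < lambda ^+ n by rewrite exprn_gt0.
have z0 : N 0 <= t' / lambda ^+ n by rewrite normc0 divr_ge0// ltW.
have grow x y : N x <= t' / lambda ^+ n -> N y <= t' / lambda ^+ n ->
    N (iter n (horner P) x - iter n (horner P) y) <= 2 * (lambda ^+ n * N (x - y)).
  move=> hx hy; have h := IH t' x y t'0 t'D hx hy.
  apply: le_trans (normc_le_dist _ (L ^+ n * (x - y))) _.
  rewrite normcM normc_multiplier_expn.
  have : 0 <= lambda ^+ n * N (x - y) by rewrite mulr_ge0 ?normc_ge0// ltW.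
  move: h; set d := lambda ^+ n * N _; nra.
have size2 x : N x <= t' / lambda ^+ n -> N (iter n (horner P) x) <= 2 * t'.
  move=> hx; have := grow x 0 hx z0; rewrite iter_fixed0// !subr0 => h.
  apply: le_trans h _; rewrite ler_pM2l// mulrC -ler_pdivlMr//.
rewrite !iterS.
set X := iter n _ a; set Y := iter n _ b.
have hXY := grow a b ha hb; rewrite -/X -/Y in hXY.
have hI := IH t' a b t'0 t'D ha hb; rewrite -/X -/Y in hI.
have hq : N (P.[X] - P.[Y] - L * (X - Y)) <= B * (2 * t') * N (X - Y).
  by apply: hB; [nra|exact: size2|exact: size2].
have -> : P.[X] - P.[Y] - L ^+ n.+1 * (a - b) =
  (P.[X] - P.[Y] - L * (X - Y)) + L * (X - Y - L ^+ n * (a - b)).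
  by rewrite exprS; ring.
apply: le_trans (le_normcD _ _) _.
rewrite normcM normc_of_real (gtr0_norm lambda0) exprS tt -(mulrA lambda (lambda ^+ n)).
have d0 : 0 <= lambda ^+ n * N (a - b) by rewrite mulr_ge0 ?normc_ge0// ltW.
move: hXY hI d0; set d := lambda ^+ n * N _ => hXY hI d0.
have h1 : B * (2 * t') * N (X - Y) <= B * (2 * t') * (2 * d).
  by apply: ler_wpM2l hXY; apply: mulr_ge0 => //; apply: mulr_ge0.
have h2 : lambda * N (X - Y - L ^+ n * (a - b)) <= lambda * (D * t' * d).
  by rewrite ler_wpM2l// ltW.
have h3 : 0 <= t' * d by rewrite mulr_ge0.
have h4 : 4 * B * (t' * d) <= D * (lambda - 1) * (t' * d) by rewrite ler_wpM2r.
have h5 : D * (lambda - 1) * (t' * d) <= lambda * (D * (lambda - 1) * (t' * d)).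
  apply: ler_peMl (ltW l1); apply: mulr_ge0 => //; apply: mulr_ge0; lra.
have -> : D * (lambda * t') * (lambda * d) =
  lambda * (D * (lambda - 1) * (t' * d)) + lambda * (D * t' * d) by ring.
have e1 : B * (2 * t') * (2 * d) = 4 * B * (t' * d) by ring.
lra.
Qed.

(** In [f z = P^n (f (z / lambda^n))] the inner value is tangent to [z / lambda^n], and [P^n] is
    nearly linear at that scale; hence the convergence. The bound on differences then passes from
    [P^n] to the limit. *)
Lemma koenigs_linearization : exists2 delta : R, 0 < delta &
  (forall z z', N z <= delta -> N z' <= delta ->
    N (f z - f z' - (z - z')) <= 1 / 2 * N (z - z')) /\
  (forall z e, N z <= delta -> 0 < e -> exists n0, forall n, (n0 <= n)%N ->
    N (iter n (horner P) (z / L ^+ n) - f z) < e).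
Proof.
have l1 := lambda1; have l0 := lambda0.
have [D D1 hD] := iter_linear_near0.
(* Since [f a] is only known to have modulus at most [2 * N a], near-linearity is used at scale
   [2 * delta], and [D * (2 * delta) = 1 / 2] is the largest value it allows. *)
pose delta := 1 / (4 * D).
have delta0 : 0 < delta by rewrite divr_gt0//; lra.
have Dd : D * delta = 1 / 4 by rewrite /delta; field; lra.
have cvg z e : N z <= delta -> 0 < e -> exists n0, forall n, (n0 <= n)%N ->
    N (iter n (horner P) (z / L ^+ n) - f z) < e.
  move=> hz e0.
  pose eps := Num.min 1 (e / (4 * delta)).
  have eps0 : 0 < eps by rewrite lt_min ltr01 divr_gt0// mulr_gt0.
  have eps1 : eps <= 1 by rewrite ge_min lexx.
  have epse : 4 * (eps * delta) <= e.
    have : eps <= e / (4 * delta) by rewrite ge_min lexx orbT.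
    rewrite ler_pdivlMr; lra.
  have [r r0 hr] := entire_deriv0 hf f0 f1 eps0.
  have [n0 hn0] := expr_unbounded (delta / r) lambda1.
  exists n0 => n nn.
  have ln0 : 0 < lambda ^+ n by rewrite exprn_gt0.
  set a := z / L ^+ n.
  have za : z = L ^+ n * a by rewrite /a mulrC divfK// multiplier_expn_neq0.
  have Na : N z = lambda ^+ n * N a by rewrite {1}za normcM normc_multiplier_expn.
  have ha : N a <= delta / lambda ^+ n by rewrite ler_pdivlMr// mulrC -Na.
  have hb : N (f a - a) <= eps * N a.
    apply: hr; apply: le_lt_trans ha _; rewrite ltr_pdivrMr// mulrC -ltr_pdivrMr//.
    exact: hn0.
  have a0 := normc_ge0 a.
  have fa : N (f a) <= 2 * N a.
    apply: le_trans (normc_le_dist _ a) _; nra.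
  have hfz : f z = iter n (horner P) (f a) by rewrite {1}za poincare_iter.
  have hh := @hD n (2 * delta) a (f a).
  have h : N (iter n (horner P) a - f z - L ^+ n * (a - f a)) <=
     D * (2 * delta) * (lambda ^+ n * N (a - f a)).
    rewrite hfz; apply: hh; [lra|lra| |].
      by apply: le_trans ha _; rewrite ler_pM2r ?invr_gt0//; lra.
    by apply: le_trans fa _; rewrite -mulrA ler_pM2l.
  apply: le_lt_trans (normc_le_dist _ (L ^+ n * (a - f a))) _.
  rewrite normcM normc_multiplier_expn.
  have : lambda ^+ n * N (a - f a) <= eps * delta.
    rewrite normc_distC; apply: le_trans (_ : lambda ^+ n * (eps * N a) <= _).
      by rewrite ler_pM2l.
    by rewrite mulrCA ler_pM2l// -Na.
  have : 0 < eps * delta by rewrite mulr_gt0.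
  move: h; rewrite (_ : D * (2 * delta) = 1 / 2); last by lra.
  set x := lambda ^+ n * _; lra.
exists delta => //; split=> // z z' hz hz'.
apply/ler_addgt0Pr => e e0.
have e4 : 0 < e / 4 by lra.
have [n0 h0] := cvg z _ hz e4; have [n1 h1] := cvg z' _ hz' e4.
pose n := maxn n0 n1.
have := h0 n (leq_maxl _ _); have := h1 n (leq_maxr _ _).
have := @hD n delta (z / L ^+ n) (z' / L ^+ n).
have ln0 : 0 < lambda ^+ n by rewrite exprn_gt0.
have eL : L ^+ n * (z / L ^+ n - z' / L ^+ n) = z - z'.
  by rewrite -mulrBl mulrC divfK// multiplier_expn_neq0.
rewrite -normc_multiplier_expn -normcM eL.
have hn x : N x <= delta -> N (x / L ^+ n) <= delta / N (L ^+ n).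
  by move=> hx; rewrite normcM normcV ler_pM2r// invr_gt0 normc_multiplier_expn.
rewrite Dd.
move=> /(_ (ltW delta0) _ (hn _ hz) (hn _ hz')).
set X := iter n _ _; set Y := iter n _ _ => h hY hX.
have {}h : N (X - Y - (z - z')) <= 1 / 4 * N (z - z') by apply: h; lra.
have -> : f z - f z' - (z - z') = (X - Y - (z - z')) - (X - f z) + (Y - f z') by ring.
apply: le_trans (le_normcD _ _) _.
have := normc_leB (X - Y - (z - z')) (X - f z).
have := normc_ge0 (z - z'); lra.
Qed.

(** The iteration [z - (f z - u)] halves the defect [f z - u], because [f] minus the identity is
    Lipschitz with constant [1 / 2]; a cluster point of the orbit solves the equation. *)
Lemma poincare_local_onto : exists2 delta : R, 0 < delta &
  forall u, N u <= delta -> exists z, f z = u.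
Proof.
have l1 := lambda1; have l0 := lambda0.
have [delta delta0 [hlip _]] := koenigs_linearization.
(* The orbit stays in the disc of radius [2 * N u], which must lie in the disc of radius [delta]. *)
exists (delta / 2) => [|u hu]; first by rewrite divr_gt0.
pose s := fix s k := if k is k'.+1 then s k' - (f (s k') - u) else 0.
have u0 := normc_ge0 u.
have hs k : N (f (s k) - u) <= 2 ^- k * N u /\ N (s k) <= 2 * (1 - 2 ^- k) * N u.
  elim: k => [|k [IH1 IH2]]; rewrite [s _]/=.
    by rewrite f0 sub0r normcN normc0 expr0 invr1 mul1r subrr mulr0 mul0r.
  have k0 : 0 < 2 ^- k :> R by rewrite invr_gt0 exprn_gt0.
  have k2 : 2 ^- k.+1 = 2 ^- k / 2 :> R by rewrite exprSr invfM.
  have h2 : N (s k - (f (s k) - u)) <= 2 * (1 - 2 ^- k.+1) * N u.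
    apply: le_trans (normc_leB _ _) _; rewrite k2; lra.
  split=> //.
  have h3 : 0 < 2 ^- k.+1 :> R by rewrite invr_gt0 exprn_gt0.
  have := hlip (s k - (f (s k) - u)) (s k).
  have -> : f (s k - (f (s k) - u)) - f (s k) - (s k - (f (s k) - u) - s k)
    = f (s k - (f (s k) - u)) - u by ring.
  have -> : s k - (f (s k) - u) - s k = - (f (s k) - u) by ring.
  rewrite normcN => h; apply: le_trans (h _ _) _; [nra|nra|].
  rewrite k2; lra.
have sb (k : nat) (i : 'I_1) : N (s k) <= delta.
  have [_ hk] := hs k; have k0 : 0 < 2 ^- k :> R by rewrite invr_gt0 exprn_gt0.
  by apply: le_trans hk _; nra.
have [l hl] := bounded_cluster sb.
exists (l ord0); apply/eqP; rewrite -subr_eq0; apply/eqP/eq0_normc; apply/le_anti.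
rewrite normc_ge0 andbT; apply/ler_addgt0Pr => e e0; rewrite add0r.
have e2 : 0 < e / 2 by lra.
have [r r0 hr] := entire_continuous hf (l ord0) e2.
have [n0 hn0] := expr_unbounded (2 * N u / e) (ltr1n R 2).
have [n [nn hn]] := hl r r0 n0.
have h1 := hr _ (hn ord0); have [h2 _] := hs n.
have h3 := hn0 n nn.
have h4 : 2 ^- n * N u < e / 2.
  by rewrite mulrC ltr_pdivrMr ?exprn_gt0// -mulrC -ltr_pdivrMr// invf_div mulrA (mulrC (N u)).
have -> : f (l ord0) - u = (f (s n) - u) - (f (s n) - f (l ord0)) by ring.
apply: le_trans (normc_leB _ _) _; lra.
Qed.

(** Near [0], [f] is a limit of the real values [P^n (x / lambda^n)]; the functional equation
    carries reality to the whole axis. *)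
Lemma poincare_real : (forall x : R, exists y, P.[of_real x] = of_real y) ->
  forall x : R, exists y, f (of_real x) = of_real y.
Proof.
have l1 := lambda1; have l0 := lambda0.
move=> hP.
have [delta delta0 [_ hcvg]] := koenigs_linearization.
have hit n x : exists y, iter n (horner P) (of_real x) = of_real y.
  elim: n => [|n [y hy]]; first by exists x.
  by have [y' hy'] := hP y; exists y'; rewrite iterS hy.
have LX n : L ^+ n = of_real (lambda ^+ n) by rewrite /of_real rmorphXn.
have small x : `|x| <= delta -> exists y, f (of_real x) = of_real y.
  move=> hx; suff Im0 : complex.Im (f (of_real x) : R[i]) = 0.
    exists (complex.Re (f (of_real x) : R[i])); move: Im0; case: (f _) => a b /= ->.
    by [].
  apply/eqP; rewrite -normr_eq0; apply/eqP/le_anti; rewrite normr_ge0 andbT.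
  apply/ler_addgt0Pr => e e0; rewrite add0r.
  have [|n0 h] := hcvg (of_real x) e _ e0; first by rewrite normc_of_real.
  have {}h := h n0 (leqnn _).
  have [y hy] := hit n0 (x / lambda ^+ n0).
  have hq : of_real x / L ^+ n0 = of_real (x / lambda ^+ n0).
    by rewrite LX /of_real fmorph_div.
  rewrite hq hy normc_distC in h.
  apply: le_trans (ltW h); apply: le_trans (Im_le_normc _).
  by case: (f _) => a b /=; rewrite oppr0 addr0.
move=> x; have [n0 hn0] := expr_unbounded (`|x| / delta) lambda1.
have ln0 : 0 < lambda ^+ n0 by rewrite exprn_gt0.
have hx : `|x / lambda ^+ n0| <= delta.
  rewrite normrM normfV (gtr0_norm ln0) ler_pdivrMr// mulrC -ler_pdivrMr//.
  by rewrite ltW// hn0.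
have [y hy] := small _ hx.
have [y' hy'] := hit n0 y; exists y'.
rewrite -hy' -hy -poincare_iter LX /of_real -rmorphM mulrC divfK//.
by rewrite gt_eqF.
Qed.

End Koenigs.

(** * A Poincare function omits at most one value *)

Section Rational.
Variable R : realType.
Local Notation C := (cplx R).
Local Notation N := (@normc R).

Lemma poly0_disc (A : {poly C}) (r : R) : 0 < r ->
  (forall z, N z <= r -> A.[z] = 0) -> A = 0.
Proof.
move=> r0 hA; apply/polyP => q; rewrite coef0; apply: eq0_normc; apply/le_anti.
rewrite normc_ge0 andbT -(pmulr_lle0 _ (exprn_gt0 q r0)); apply: cauchy_coef => // z hz.
by rewrite hA ?hz// normc0.
Qed.

(** The zeros of [G] are points where a common factor was cancelled; multiplying [A - B] by [G]
    absorbs them. *)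
Lemma poly_eq_disc (A B G : {poly C}) (r : R) : 0 < r -> G != 0 ->
  (forall z, N z <= r -> G.[z] != 0 -> A.[z] = B.[z]) -> A = B.
Proof.
move=> r0 G0 h; apply/eqP; rewrite -subr_eq0.
have /eqP : (A - B) * G = 0.
  apply: (poly0_disc r0) => z hz; rewrite !hornerE.
  have [->|Gz] := eqVneq G.[z] 0; first by rewrite mulr0.
  by rewrite h// subrr mul0r.
by rewrite mulf_eq0 (negbTE G0) orbF.
Qed.

Lemma size_comp_scaleX (L : C) (Q : {poly C}) : L != 0 ->
  (size (Q \Po (L *: 'X))).-1 = (size Q).-1.
Proof. by move=> L0; rewrite size_comp_poly size_scale// size_polyX muln1. Qed.

(** Write [f = E1 / D1] in lowest terms and let [m] be the degree of [P]. By the functional equation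
    [D1 ^+ m] divides [D1 (L z)], so comparing degrees makes [D1] constant. Then [F (L z) = P (F z)]
    for a polynomial [F], which is constant for the same reason, against injectivity. *)
Lemma poincare_not_rational (P : {poly C}) (L : C) (f : C -> C) (D E : {poly C}) (r : R) :
  (2 < size P)%N -> L != 0 -> 0 < r -> 
  (forall z, f (L * z) = P.[f z]) ->
  (forall z z', N z <= r -> N z' <= r -> f z = f z' -> z = z') ->
  D != 0 -> ~ (forall z, N z <= r -> D.[z] * f z = E.[z]).
Proof.
move=> sP L0 r0 hfP finj D0 hDE.
pose g := gcdp D E; have g0 : g != 0 by rewrite gcdp_eq0 negb_and D0.
pose D1 := D %/ g; pose E1 := E %/ g.
have Dg : D = D1 * g by rewrite divpK// dvdp_gcdl.
have Eg : E = E1 * g by rewrite divpK// dvdp_gcdr.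
have D10 : D1 != 0 by apply: contraNneq D0 => h; rewrite Dg h mul0r.
have cop : coprimep D1 E1 by apply: coprimep_div_gcd; rewrite D0.
have hD1 z : N z <= r -> g.[z] != 0 -> D1.[z] * f z = E1.[z].
  move=> hz gz; apply: (mulIf gz); rewrite mulrAC -!hornerM -Dg -Eg; exact: hDE.
pose LX : {poly C} := L *: 'X.
have LXE (Q : {poly C}) z : (Q \Po LX).[z] = Q.[L * z].
  by rewrite horner_comp hornerZ hornerX.
have LXn0 (Q : {poly C}) : Q != 0 -> Q \Po LX != 0.
  move=> Q0; rewrite comp_poly_eq0//.
  by rewrite size_scale// size_polyX.
pose G := g * (g \Po LX).
have G0 : G != 0 by rewrite mulf_neq0// LXn0.
pose rr := Num.min r (r / N L).
have NL0 : 0 < N L.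
  by rewrite lt_neqAle normc_ge0 andbT eq_sym; apply: contra L0 => /eqP/eq0_normc ->.
have rr0 : 0 < rr by rewrite lt_min r0 divr_gt0.
have hrr z : N z <= rr -> N z <= r /\ N (L * z) <= r.
  by rewrite le_min normcM ler_pdivlMr// (mulrC _ (N L)) => /andP[].
have hG z : G.[z] != 0 -> g.[z] != 0 /\ g.[L * z] != 0.
  by rewrite hornerM LXE mulf_eq0 negb_or => /andP[].
pose m := (size P).-1; have m2 : (1 < m)%N by rewrite /m; case: (size P) sP => [|[]].
have small k : (k * m <= k)%N -> k = 0%N.
  by case: k => // k; rewrite -{2}[k.+1]muln1 leq_pmul2l// leqNgt m2.
have sPm : size P = m.+1 by rewrite prednK// (leq_trans _ sP).
(* This is [P (E1 / D1)] cleared of denominators. Modulo [D1] only the term in [E1 ^+ m] survives,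
   which gives coprimality with [D1]. *)
pose Ph := \sum_(i < m.+1) P`_i *: (E1 ^+ i * D1 ^+ (m - i)).
have hPh : (D1 \Po LX) * Ph = (E1 \Po LX) * D1 ^+ m.
  apply: (poly_eq_disc rr0 G0) => z /hrr [hz hLz] /hG [gz gLz].
  rewrite !hornerM !LXE horner_exp -(hD1 _ hLz gLz) -mulrA; congr (_ * _).
  rewrite hfP (horner_coef P) sPm mulr_suml horner_sum; apply: eq_bigr => i _.
  rewrite hornerZ hornerM !horner_exp -hD1// exprMn -[RHS]mulrA; congr (_ * _).
  have -> : D1.[z] ^+ m = D1.[z] ^+ i * D1.[z] ^+ (m - i).
    by rewrite -exprD subnKC// -ltnS.
  by rewrite [RHS]mulrA [f z ^+ i * _]mulrC.
have copPh : coprimep (D1 ^+ m) Ph.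
  apply: coprimep_expl; rewrite /Ph big_ord_recr /= subnn expr0 mulr1.
  have -> : \sum_(i < m) P`_i *: (E1 ^+ i * D1 ^+ (m - i)) =
      (\sum_(i < m) P`_i *: (E1 ^+ i * D1 ^+ (m - i).-1)) * D1.
    rewrite mulr_suml; apply: eq_bigr => i _.
    by rewrite -scalerAl -mulrA -exprSr prednK// subn_gt0.
  rewrite coprimep_addl_mul coprimepZr ?coprimep_expr//.
  by rewrite -lead_coefE lead_coef_eq0 -size_poly_eq0 sPm.
have dv : D1 ^+ m %| D1 \Po LX.
  by rewrite -(Gauss_dvdpl _ copPh) hPh dvdp_mull.
have sD1 : (size D1).-1 = 0%N.
  have := dvdp_leq (LXn0 _ D10) dv.
  have D1m : D1 ^+ m != 0 by rewrite expf_neq0.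
  have := size_exp D1 m; have := size_comp_scaleX D1 L0.
  have := D1m; have := LXn0 _ D10; rewrite -!size_poly_gt0 -/LX.
  case: (size (D1 \Po LX)) => // a _; case: (size (D1 ^+ m)) => // b _ /= -> ->.
  by rewrite ltnS; exact: small.
have [c hc] : exists c, D1 = c%:P by exists D1`_0; apply: size1_polyC; case: (size D1) sD1 => [|[]].
have c0 : c != 0 by apply: contraNneq D10 => c0; rewrite hc c0.
pose F := c^-1 *: E1.
have hF z : N z <= r -> g.[z] != 0 -> f z = F.[z].
  by move=> hz gz; rewrite hornerZ -hD1// hc hornerC mulKf.
have FL : F \Po LX = P \Po F.
  apply: (poly_eq_disc rr0 G0) => z /hrr [hz hLz] /hG [gz gLz].
  by rewrite LXE horner_comp -!hF.
have sF : (size F).-1 = 0%N.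
  by apply: small; rewrite -{2}(size_comp_scaleX F L0) -/LX FL size_comp_poly -/m mulnC.
have [b hb] : exists b, F = b%:P by exists F`_0; apply: size1_polyC; case: (size F) sF => [|[]].
suff : ('X : {poly C}) * g = 0.
  by move/eqP; rewrite mulf_eq0 polyX_eq0 (negbTE g0).
have [z1 hz1 gz1] : exists2 z1, N z1 <= r & g.[z1] != 0.
  apply: contrapT => h; move/negP: g0; apply; apply/eqP; apply: (poly0_disc r0) => z hz.
  by apply/eqP; apply: contrapT => /negP gz; apply: h; exists z.
(* A constant injective [f] forces every admissible [z] to equal [z1], an absurd polynomial
   identity. *)
have : ('X - z1%:P) = 0 :> {poly C}.
  apply: (poly_eq_disc r0 g0) => z hz gz; rewrite !hornerE.
  by apply/eqP; rewrite subr_eq0; apply/eqP/finj => //; rewrite !hF// hb !hornerC.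
by move/eqP; rewrite polyXsubC_eq0.
Qed.

(* [q.[z]] is the sum over the roots [s] of the first [K] terms of the geometric
   series of [1 / (s - z)], and [H' / H] is minus the sum of the [1 / (s - z)]. *)
Lemma log_deriv_expansion (H : {poly C}) (K : nat) (rho : R) : 0 < rho ->
  (forall s, root H s -> rho <= N s) ->
  exists2 q : {poly C}, (size q <= K)%N & forall z, N z <= rho / 2 ->
    N (H^`().[z] + q.[z] * H.[z]) <=
      (size H).-1%:R * ((N z / rho) ^+ K * (2 / rho)) * N H.[z].
Proof.
move=> rho0 hr; have [->|H0] := eqVneq H 0.
  exists 0; first by rewrite size_poly0.
  by move=> z _; rewrite deriv0 !horner0 mulr0 addr0 normc0 mulr0.
have [rs Hrs] := closed_field_poly_normal H.
have lc : lead_coef H != 0 by rewrite lead_coef_eq0.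
have -> : (size H).-1 = size rs by rewrite Hrs size_scale// size_prod_XsubC.
have {}hr : forall s, s \in rs -> rho <= N s.
  by move=> s hs; apply: hr; rewrite Hrs rootZ// root_prod_XsubC.
suff [q sq hq] : exists2 q : {poly C}, (size q <= K)%N & forall z, N z <= rho / 2 ->
    N ((\prod_(s <- rs) ('X - s%:P))^`().[z] + q.[z] * (\prod_(s <- rs) ('X - s%:P)).[z]) <=
      (size rs)%:R * ((N z / rho) ^+ K * (2 / rho)) * N (\prod_(s <- rs) ('X - s%:P)).[z].
  exists q => // z /hq h; rewrite Hrs derivZ !hornerZ mulrCA -mulrDr !normcM mulrCA.
  by rewrite ler_wpM2l// normc_ge0.
elim: rs hr {Hrs} => [|s rs IH] hr.
  exists 0; first by rewrite size_poly0.
  by move=> z _; rewrite big_nil derivC !hornerC mul0r addr0 normc0 mul0r mul0r.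
have [|q sq hq] := IH; first by move=> t ht; apply: hr; rewrite inE ht orbT.
have hs : rho <= N s by apply: hr; rewrite mem_head.
have s0 : s != 0 by apply: contraTneq hs => ->; rewrite normc0 -ltNge.
(* The new root adds its truncated geometric series. The remainder [(z / s) ^+ K], divided by
   [z - s] of modulus at least [rho / 2], contributes one more [eta]. *)
exists (q + \poly_(k < K) s^-1 ^+ k.+1).
  by rewrite (leq_trans (size_polyD _ _))// geq_max sq size_poly.
move=> z hz; rewrite big_cons.
set G := \prod_(_ <- _) _ in hq *; move/(_ _ hz): hq; set eta := _ ^+ K * _ => hq.
rewrite derivM derivXsubC mul1r !hornerD !hornerM !hornerXsubC (horner_poly K).
have geo : (\sum_(i < K) s^-1 ^+ i.+1 * z ^+ i) * (z - s) = (z / s) ^+ K - 1.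
  rewrite subrX1 mulr_suml [RHS]mulr_sumr; apply: eq_bigr => i _.
  by rewrite expr_div_n exprS -exprVn; field.

have -> : G.[z] + (z - s) * G^`().[z] +
    (q.[z] + \sum_(i < K) s^-1 ^+ i.+1 * z ^+ i) * ((z - s) * G.[z]) =
  (z - s) * (G^`().[z] + q.[z] * G.[z]) + (z / s) ^+ K * G.[z].
  have -> : (z / s) ^+ K = (\sum_(i < K) s^-1 ^+ i.+1 * z ^+ i) * (z - s) + 1.
    by rewrite geo subrK.
  ring.
apply: le_trans (le_normcD _ _) _; rewrite !normcM [size _]/= -natr1 !mulrDl mul1r; apply: lerD.
  rewrite [leRHS]mulrCA; apply: ler_wpM2l; [exact: normc_ge0|exact: hq].
have zs : rho / 2 <= N (z - s).
  have := normc_le_dist s z; rewrite normc_distC; lra.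
rewrite mulrA; apply: ler_wpM2r; first exact: normc_ge0.
rewrite /eta normcX normcM normcV -mulrA -[leLHS]mulr1; apply: ler_pM => //.
- by rewrite exprn_ge0// mulr_ge0 ?normc_ge0// invr_ge0 normc_ge0.
- apply: lerXn2r; rewrite ?nnegrE ?mulr_ge0 ?invr_ge0 ?normc_ge0 ?(ltW rho0)//.
  by rewrite ler_wpM2l ?normc_ge0// lef_pV2 ?posrE//; apply: lt_le_trans hs.
- rewrite mulrC mulrA ler_pdivlMr// mul1r; lra.
Qed.

End Rational.

(** * Logarithmic derivatives at omitted values *)

Section Omitted.
Variables (R : realType) (P : {poly cplx R}) (lambda : R) (f : cplx R -> cplx R).
Local Notation C := (cplx R).
Local Notation N := (@normc R).
Local Notation L := (of_real lambda).
Hypothesis lambda1 : 1 < lambda.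
Hypothesis sP : (2 < size P)%N.
Hypothesis P0 : P.[0] = 0.
Hypothesis P1 : P^`().[0] = L.
Hypothesis hf : entire f.
Hypothesis hfP : forall z, f (L * z) = P.[f z].
Hypothesis f0 : f 0 = 0.
Hypothesis f1 : derive1 f 0 = 1.

(** This is [w - f_n], where [f_n] tends to [f] near [0]; its roots are [lambda^n] times the
    preimages of [w] under [P^n]. *)
Let rescaled (w : C) n : {poly C} := w%:P - (poly_iter P n \Po ((L ^+ n)^-1 *: 'X)).

Let rescaledE w n z : (rescaled w n).[z] = w - iter n (horner P) (z / L ^+ n).
Proof.
rewrite hornerD hornerN hornerC horner_comp hornerZ hornerX horner_poly_iter.
by rewrite mulrC.
Qed.

Let deriv_rescaled w w' n : (rescaled w n)^`() = (rescaled w' n)^`().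
Proof. by rewrite /rescaled !derivB !derivC. Qed.

Let deriv_rescaled0 w n : (rescaled w n)^`().[0] = -1.
Proof.
rewrite /rescaled derivB derivC sub0r hornerN deriv_comp hornerM horner_comp.
rewrite derivZ derivX !hornerZ hornerX hornerC mulr0 mulr1 deriv_poly_iter0// P1.
by rewrite mulfV// multiplier_expn_neq0.
Qed.

Let size_rescaled w n : ((size (rescaled w n)).-1 <= (size P).-1 ^ n)%N.
Proof.
have d0 : (0 < (size P).-1)%N by case: (size P) sP => [|[]].
have L0 : (L ^+ n)^-1 != 0 by rewrite invr_eq0 multiplier_expn_neq0.
rewrite -(size_poly_iter P n) -(size_comp_scaleX (poly_iter P n) L0).
set Q := _ \Po _.
have sQ : (0 < (size Q).-1)%N by rewrite size_comp_scaleX// size_poly_iter expn_gt0 d0.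
rewrite -!subn1 leq_sub2r// (leq_trans (size_polyD _ _))// geq_max size_polyN leqnn andbT.
by rewrite (leq_trans (size_polyC_leq1 _))//; case: (size Q) sQ.
Qed.

(** As [f] covers a disc of radius [dl], a root of [rescaled w n] of modulus below
    [dl * lambda ^+ n] would make [w] a value of [f]. So [log_deriv_expansion] applies on a disc
    growing with [n]. *)
Lemma omitted_log_deriv : exists delta K, [/\ 0 < delta, (0 < K)%N &
  forall w, (forall z, f z != w) -> forall n, exists q : {poly C},
    [/\ (size q <= K)%N, q.[0] * w = 1 & forall z, N z <= delta ->
      N ((rescaled w n)^`().[z] + q.[z] * (rescaled w n).[z]) <=
      (delta * lambda ^+ n)^-1 * N (rescaled w n).[z]]].
Proof.
have l1 := lambda1; have l0 : 0 < lambda by lra.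
have [dl dl0 onto] := poincare_local_onto lambda1 P0 P1 hf hfP f0 f1.
(* The number of roots, at most the [n]-th power of the degree, is then outweighed by the factor
   [lambda ^- (n * K.+1)] in the truncation error. *)
have [K hK] := expr_unbounded (size P).-1%:R lambda1.
exists (dl / 2), K.+1; split => //; first by rewrite divr_gt0.
move=> w hw n.
have ln0 : 0 < lambda ^+ n by rewrite exprn_gt0.
have [|s|q sq hq] := @log_deriv_expansion R (rescaled w n) K.+1 (dl * lambda ^+ n).
- by rewrite mulr_gt0.
- rewrite rootE rescaledE subr_eq0 => /eqP hs; rewrite leNgt; apply/negP => sd.
  have [|z hz] := onto (s / L ^+ n).
    by rewrite normcM normcV normc_multiplier_expn// ler_pdivrMr// ltW.
  have /eqP[] := hw (L ^+ n * z); by rewrite (poincare_iter hfP) hz.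
exists q; split => //.
(* At [0] the error vanishes because [K.+1] is positive, and the derivative there is [-1]. *)
- have := hq 0; rewrite normc0 mul0r expr0n /= mul0r mulr0 mul0r.
  rewrite divr_ge0 ?mulr_ge0 ?(ltW dl0) ?(ltW ln0)// => /(_ isT) h.
  have : N ((rescaled w n)^`().[0] + q.[0] * (rescaled w n).[0]) = 0.
    by apply/le_anti; rewrite h normc_ge0.
  move/eq0_normc; rewrite deriv_rescaled0 rescaledE mul0r iter_fixed0// subr0.
  by move/eqP; rewrite addrC subr_eq0 => /eqP.
- move=> z hz.
  have ln1 : 1 <= lambda ^+ n by rewrite exprn_ege1// ltW.
  have z0 := normc_ge0 z.
  apply: le_trans (hq z _) _.
    by apply: le_trans hz _; rewrite ler_pM2r ?invr_gt0// ler_peMr// ltW.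
  apply: ler_wpM2r; first exact: normc_ge0.
  have -> : (dl / 2 * lambda ^+ n)^-1 = 1 * (2 / (dl * lambda ^+ n)).
    by field; rewrite !gt_eqF.
  rewrite mulrA; apply: ler_wpM2r; first by rewrite divr_ge0// mulr_ge0// ltW.
  apply: le_trans (_ : (lambda ^+ K.+1) ^+ n * ((lambda ^+ n)^-1) ^+ K.+1 <= _); last first.
    by rewrite -exprM -exprVn -exprM mulnC exprVn divff// gt_eqF// exprn_gt0.
  apply: ler_pM; rewrite ?ler0n// ?exprn_ge0// ?mulr_ge0 ?invr_ge0 ?mulr_ge0 ?(ltW dl0) ?(ltW ln0)//.
    apply: le_trans (_ : ((size P).-1 ^ n)%:R <= _); first by rewrite ler_nat size_rescaled.
    by rewrite natrX; apply: lerXn2r; rewrite ?nnegrE ?ler0n ?exprn_ge0 ?(ltW l0)// ltW// hK.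
  apply: lerXn2r; rewrite ?nnegrE ?mulr_ge0 ?invr_ge0 ?mulr_ge0 ?(ltW dl0) ?(ltW ln0)//.
  rewrite invfM mulrA ler_piMl ?invr_ge0 ?(ltW ln0)// ler_pdivrMr// mul1r.
  by apply: le_trans hz _; lra.
Qed.

(* The rescaled iterates [f_n] tend to [f], and for omitted [w0], [w1] they satisfy
   [f_n' ~ q0_n (w0 - f_n) ~ q1_n (w1 - f_n)] with [q0_n], [q1_n] of bounded degree.
   A cluster point of the normalized pair [(q0_n, q1_n)] makes [f] rational. *)
Lemma poincare_omits_at_most_one (w0 w1 : C) :
  (forall z, f z != w0) -> (forall z, f z != w1) -> w0 = w1.
Proof.
move=> hw0 hw1; apply/eqP; apply: contrapT => /negP w01.
have l1 := lambda1; have l0 : 0 < lambda by lra.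
have [d1 [K [d10 K0 hq]]] := omitted_log_deriv.
have [d2 d20 [hlip hcvg]] := koenigs_linearization lambda1 P0 P1 hf hfP f0 f1.
pose delta := Num.min 1 (Num.min d1 d2).
have delta0 : 0 < delta by rewrite !lt_min ltr01 d10.
have deltaP z : N z <= delta -> [/\ N z <= 1, N z <= d1 & N z <= d2].
  by rewrite !le_min => /and3P[].
have [q0 hq0] := choice (hq w0 hw0); have [q1 hq1] := choice (hq w1 hw1).
pose u n (i : 'I_(K + K)) : C :=
  match fintype.split i with inl k => (q0 n)`_k | inr k => (q1 n)`_k end.
pose M n := \sum_i N (u n i).
have w0p : 0 < N w0.
  rewrite lt_neqAle normc_ge0 andbT eq_sym; apply: contraNneq (hw0 0) => /eq0_normc ->.
  by rewrite f0.
have MM n i : N (u n i) <= M n.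
  by rewrite /M (bigD1 i)//= lerDl sumr_ge0// => j _; exact: normc_ge0.
(* The relation [q0(0) * w0 = 1] keeps the normalizing factor away from [0], so normalization does
   not spoil errors of order [lambda ^- n]. *)
have M0 n : (N w0)^-1 <= M n.
  have [_ h _] := hq0 n; have := MM n (lshift K (Ordinal K0)).
  rewrite /u (unsplitK (inl _)) /= -horner_coef0; apply: le_trans.
  by rewrite -[leLHS]mul1r ler_pdivrMr// -normcM h normc1.
have Mp n : 0 < M n by apply: lt_le_trans (M0 n); rewrite invr_gt0.
pose v n i : C := u n i / of_real (M n).
have Nv n i : N (v n i) = N (u n i) / M n by rewrite normcM normcV normc_of_real gtr0_norm.
have Sv n : \sum_i N (v n i) = 1.
  under eq_bigr do rewrite Nv.
  by rewrite -mulr_suml -/(M n) divff// (gt_eqF (Mp n)).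
have vb n i : N (v n i) <= 1 by rewrite Nv ler_pdivrMr// mul1r.
have [l hl] := bounded_cluster vb.
pose SA (y : 'I_(K + K) -> C) (z : C) := \sum_(k < K) y (lshift K k) * z ^+ k.
pose SB (y : 'I_(K + K) -> C) (z : C) := \sum_(k < K) y (rshift K k) * z ^+ k.
pose T y z x := SA y z * (w0 - x) - SB y z * (w1 - x).
have normS (y : 'I_(K + K) -> C) (g : 'I_K -> 'I_(K + K)) z : N z <= 1 ->
    N (\sum_k y (g k) * z ^+ k) <= \sum_k N (y (g k)).
  move=> z1; elim/big_ind2: _ => [|x1 x2 y1 y2 h1 h2|k _]; first by rewrite normc0.
    by apply: le_trans (le_normcD _ _) _; exact: lerD.
  by rewrite normcM normcX ler_piMr ?normc_ge0// exprn_ile1 ?normc_ge0.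
have SAB y z : N z <= 1 -> N (SA y z) + N (SB y z) <= \sum_i N (y i).
  by move=> z1; rewrite big_split_ord /=; apply: lerD; exact: normS.
have TB y z x : N z <= 1 -> N (T y z x) <= (\sum_i N (y i)) * (N w0 + N w1 + 2 * N x).
  move=> z1; have h := SAB y z z1.
  have h0 := normc_leB w0 x; have h1 := normc_leB w1 x.
  apply: le_trans (normc_leB _ _) _; rewrite !normcM.
  have a0 := normc_ge0 (SA y z); have b0 := normc_ge0 (SB y z).
  have c0 := normc_ge0 (w0 - x); have c1 := normc_ge0 (w1 - x); have x0 := normc_ge0 x.
  have e0 := normc_ge0 w0; have e1 := normc_ge0 w1.
  apply: le_trans (_ : (N (SA y z) + N (SB y z)) * (N w0 + N w1 + 2 * N x) <= _).
    by rewrite mulrDl; apply: lerD; apply: ler_wpM2l => //; lra.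
  by apply: ler_wpM2r => //; lra.
have qE n z : (q0 n).[z] = SA (u n) z /\ (q1 n).[z] = SB (u n) z.
  have [s0 _ _] := hq0 n; have [s1 _ _] := hq1 n.
  rewrite (horner_coef_wide _ s0) (horner_coef_wide _ s1).
  by split; apply: eq_bigr => k _; rewrite /u ?(unsplitK (inl _)) ?(unsplitK (inr _)).
have Tv n z x : T (v n) z x = T (u n) z x / of_real (M n).
  rewrite /T mulrBl !(mulrAC _ _ (of_real _)^-1) /SA /SB.
  by congr (_ * _ - _ * _); rewrite mulr_suml; apply: eq_bigr => k _; rewrite mulrAC.
(* [w0 - f_n] and [w1 - f_n] have the same derivative, so subtracting the two estimates eliminates
   it. *)
have Tu n z : N z <= delta -> let fn := iter n (horner P) (z / L ^+ n) in
    N (T (u n) z fn) <= (d1 * lambda ^+ n)^-1 * (N (w0 - fn) + N (w1 - fn)).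
  move=> /deltaP[_ zd _] /=.
  have [_ _ /(_ z zd)] := hq0 n; have [_ _ /(_ z zd)] := hq1 n.
  rewrite (deriv_rescaled w1 w0) !rescaledE; have [-> ->] := qE n z.
  set D := _.[z]; set fn := iter _ _ _ => h1 h0.
  have -> : T (u n) z fn = (D + SA (u n) z * (w0 - fn)) - (D + SB (u n) z * (w1 - fn)).
    by rewrite /T; ring.
  by apply: le_trans (normc_leB _ _) _; rewrite [leRHS]mulrDr; apply: lerD.
have Tl z : N z <= delta -> T l z (f z) = 0.
  move=> zd; have [z1 zd1 zd2] := deltaP z zd.
  apply: eq0_normc; apply/le_anti; rewrite normc_ge0 andbT; apply/ler_addgt0Pr => eta eta0.
  rewrite add0r.
  pose S := N w0 + N w1 + 2 * N (f z) + 2.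
  have S0 : 2 <= S by rewrite lerDr !addr_ge0 ?mulr_ge0 ?normc_ge0.
  (* The three errors come from the relation at stage [n], from [v n - l] and from [fn - f z]; they
     are at most [e], [k2 * e * S] and [e], within [e * den]. *)
  pose k2 : R := (K + K)%:R; have k20 : 0 <= k2 by rewrite ler0n.
  pose den := k2 * S + 3; have den0 : 0 < den.
    by have := mulr_ge0 k20 (le_trans (ler0n R 2) S0); rewrite /den; lra.
  pose e := Num.min 1 (eta / den).
  have e0 : 0 < e by rewrite lt_min ltr01 divr_gt0.
  have e1 : e <= 1 by rewrite ge_min lexx.
  have ed : e * den <= eta by rewrite -ler_pdivlMr// ge_min lexx orbT.
  have [n0 hn0] := hcvg z e zd2 e0.
  have [n1 hn1] := expr_unbounded (N w0 * S / (d1 * e)) lambda1.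
  have [n [nn hn]] := hl e e0 (maxn n0 n1).
  move: nn; rewrite geq_max => /andP[/hn0 hfn /hn1 hln].
  have := Tu n z zd; set fn := iter n _ _ in hfn * => /= hT.
  have ln0 : 0 < lambda ^+ n by rewrite exprn_gt0.
  have -> : T l z (f z) = T (v n) z fn - T (fun i => v n i - l i) z (f z)
      + (SA (v n) z - SB (v n) z) * (fn - f z).
    have -> : T (fun i => v n i - l i) z (f z) = T (v n) z (f z) - T l z (f z).
      rewrite /T; have -> : SA (fun i => v n i - l i) z = SA (v n) z - SA l z.
        by rewrite /SA -sumrB; apply: eq_bigr => k _; rewrite mulrBl.
      have -> : SB (fun i => v n i - l i) z = SB (v n) z - SB l z.
        by rewrite /SB -sumrB; apply: eq_bigr => k _; rewrite mulrBl.
      ring.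
    by rewrite /T; ring.
  have b1 : N (T (v n) z fn) <= e.
    have fnb : N (w0 - fn) + N (w1 - fn) <= S.
      have := normc_leB w0 fn; have := normc_leB w1 fn.
      have := normc_le_dist fn (f z); rewrite /S; lra.
    rewrite Tv normcM normcV normc_of_real (gtr0_norm (Mp n)) ler_pdivrMr//.
    apply: le_trans hT _; rewrite mulrC ler_pdivrMr ?mulr_gt0//.
    apply: le_trans fnb _.
    have h1 : N w0 * S <= lambda ^+ n * (d1 * e).
      by rewrite -ler_pdivrMr ?mulr_gt0// ltW.
    have h2 : N w0 * M n * S >= S.
      by rewrite ler_peMl//; [lra|rewrite mulrC -ler_pdivrMr// mul1r M0].
    apply: le_trans h2 _; rewrite mulrAC.
    have -> : e * M n * (d1 * lambda ^+ n) = lambda ^+ n * (d1 * e) * M n by ring.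
    by rewrite ler_wpM2r// ltW.
  have b2 : N (T (fun i => v n i - l i) z (f z)) <= k2 * e * S.
    apply: le_trans (TB _ _ _ z1) _; apply: ler_pM.
    - by rewrite sumr_ge0// => i _; exact: normc_ge0.
    - by rewrite !addr_ge0 ?mulr_ge0 ?normc_ge0.
    - apply: le_trans (_ : \sum_(i < K + K) e <= _).
        by apply: ler_sum => i _; rewrite ltW.
      by rewrite sumr_const card_ord -mulr_natl.
    - by rewrite /S; lra.
  have b3 : N ((SA (v n) z - SB (v n) z) * (fn - f z)) <= e.
    rewrite normcM -[leRHS]mul1r; apply: ler_pM; rewrite ?normc_ge0 ?(ltW hfn)//.
    apply: le_trans (normc_leB _ _) _; rewrite -(Sv n); exact: SAB.
  apply: le_trans (le_normcD _ _) _.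
  have := normc_leB (T (v n) z fn) (T (fun i => v n i - l i) z (f z)).
  have E : k2 * e * S = e * den - 3 * e by rewrite /den; ring.
  rewrite {}E in b2; lra.
pose A : {poly C} := \sum_(k < K) l (lshift K k) *: 'X^k.
pose B : {poly C} := \sum_(k < K) l (rshift K k) *: 'X^k.
have coefAB (y : 'I_K -> C) (k : 'I_K) : (\sum_(k < K) y k *: 'X^k)`_k = y k.
  rewrite coef_sum (bigD1 k)//= coefZ coefXn eqxx mulr1 big1 ?addr0// => j jk.
  by rewrite coefZ coefXn eq_sym (inj_eq val_inj) (negbTE jk) mulr0.
have hornerAB (y : 'I_K -> C) z : (\sum_(k < K) y k *: 'X^k).[z] = \sum_(k < K) y k * z ^+ k.
  by rewrite horner_sum; apply: eq_bigr => k _; rewrite hornerZ hornerXn.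
have hAB z : N z <= delta -> A.[z] * (w0 - f z) = B.[z] * (w1 - f z).
  by move=> /Tl /eqP; rewrite /T subr_eq0 /A /B !hornerAB => /eqP.
(* The moduli of the entries of each [v n] sum to 1, which a zero cluster point would contradict. *)
have AB0 : ~ (A = 0 /\ B = 0).
  move=> [A0 B0].
  have li i : l i = 0.
    rewrite -(splitK i); case: (fintype.split i) => k /=.
      by rewrite -(coefAB (fun k => l (lshift K k)) k) -/A A0 coef0.
    by rewrite -(coefAB (fun k => l (rshift K k)) k) -/B B0 coef0.
  have [e [e0 ek]] : exists e : R, 0 < e /\ (K + K)%:R * e < 1.
    exists ((K + K).+1%:R)^-1; split; first by rewrite invr_gt0.
    by rewrite ltr_pdivrMr// mul1r ltr_nat.
  have [n [_ hn]] := hl _ e0 0%N.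
  have : \sum_i N (v n i) <= \sum_(i < K + K) e.
    by apply: ler_sum => i _; have := hn i; rewrite li subr0 => /ltW.
  by rewrite Sv sumr_const card_ord -mulr_natl leNgt ek.
(* The relation [A (w0 - f) = B (w1 - f)] reads [(A - B) f = w0 A - w1 B]. *)
apply: (@poincare_not_rational R P L f (A - B) (w0 *: A - w1 *: B) delta) => //.
- by have := multiplier_expn_neq0 lambda1 1; rewrite expr1.
- move=> z z' /deltaP[_ _ hz] /deltaP[_ _ hz'] ff; have := hlip z z' hz hz'.
  rewrite ff subrr sub0r normcN => h; apply/eqP; rewrite -subr_eq0; apply/eqP/eq0_normc.
  by apply/le_anti; rewrite normc_ge0 andbT; lra.
- apply/eqP => /eqP; rewrite subr_eq0 => /eqP AB.
  have A0 : A = 0.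
    apply: (poly0_disc delta0) => z /hAB; rewrite -AB => /eqP.
    rewrite -subr_eq0 -mulrBr.
    have -> : w0 - f z - (w1 - f z) = w0 - w1 by ring.
    by rewrite mulf_eq0 subr_eq0 (negbTE w01) orbF => /eqP.
  by apply: AB0; split => //; rewrite -AB.
- move=> z /hAB h; rewrite !hornerD !hornerN !hornerZ.
  move/eqP: h; rewrite -subr_eq0 => /eqP h; apply/eqP; rewrite -subr_eq0 -oppr_eq0 -h.
  by apply/eqP; ring.
Qed.

End Omitted.

(** * Preimages of zero *)

Section Growth.
Variable R : realType.
Local Notation C := (cplx R).
Local Notation N := (@normc R).

Lemma horner_unbounded (Q : {poly C}) (A : R) : (1 < size Q)%N ->
  exists M : R, forall z, M < N z -> A < N Q.[z].
Proof.
elim/poly_ind: Q A => [|Q c IH] A; first by rewrite size_poly0.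
rewrite size_MXaddC; case: ifP => // _; rewrite ltnS size_poly_gt0 => Q0.
have c0 := normc_ge0 c.
have key z : N Q.[z] * N z - N c <= N (Q * 'X + c%:P).[z].
  rewrite hornerMXaddC -normcM.
  have := normc_le_dist (Q.[z] * z) (- c); rewrite opprK normcN; lra.
have [s1|s1] := leqP (size Q) 1.
  have [a Qa] : exists a, Q = a%:P by exists Q`_0; exact: size1_polyC.
  have a0 : 0 < N a.
    rewrite lt_neqAle normc_ge0 andbT eq_sym; apply: contraNneq Q0 => /eq0_normc a0.
    by rewrite Qa a0.
  exists ((A + N c) / N a) => z; rewrite ltr_pdivrMr// => h.
  by have := key z; rewrite Qa hornerC; lra.
have [M hM] := IH (`|A| + N c) s1.
exists (Num.max M 1) => z; rewrite gt_max => /andP[/hM h z1].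
apply: lt_le_trans (key z).
have := ler_norm A; have := normr_ge0 A; nra.
Qed.

(** With [P = Q * 'X] and [Q] nonconstant, [P] increases the modulus wherever [Q] exceeds 1 in
    modulus, so orbits starting far out never reach [0]. *)
Lemma preimages0_bounded (P : {poly C}) : (2 < size P)%N -> P.[0] = 0 ->
  exists2 M : R, 0 < M & forall n w, iter n (horner P) w = 0 -> N w <= M.
Proof.
move=> sP P0; have : root P 0 by rewrite rootE P0.
move/factor_theorem => [Q]; rewrite subr0 => PQ.
have Q0 : Q != 0 by apply: contraTneq sP => Q0; rewrite PQ Q0 mul0r size_poly0.
have sQ : (1 < size Q)%N by move: sP; rewrite PQ size_mulX.
have [M hM] := horner_unbounded 1 sQ.
exists (Num.max M 1) => [|n w hn]; first by rewrite lt_max ltr01 orbT.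
rewrite leNgt; apply/negP => hw.
suff : Num.max M 1 < N (iter n (horner P) w).
  by rewrite hn normc0 gt_max => /andP[_]; rewrite ltr10.
elim: n {hn} => //= n IH; apply: (lt_trans IH).
move: IH; rewrite gt_max => /andP[/hM h z1].
have -> z : P.[z] = Q.[z] * z by rewrite PQ hornerMX.
rewrite normcM ltr_pMl//; exact: lt_trans ltr01 z1.
Qed.

Lemma preimage0_neq0 (P : {poly C}) : (2 < size P)%N -> P.[0] = 0 ->
  P^`().[0] != 0 -> exists2 r : C, r != 0 & P.[r] = 0.
Proof.
move=> sP P0 P1; have : root P 0 by rewrite rootE P0.
move/factor_theorem => [Q]; rewrite subr0 => PQ.
have Q0 : Q != 0 by apply: contraTneq sP => Q0; rewrite PQ Q0 mul0r size_poly0.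
have /closed_rootP [r hr] : size Q != 1%N.
  by move: sP; rewrite PQ size_mulX//; case: (size Q) => [|[]].
exists r; last by rewrite PQ hornerMX (rootP hr) mul0r.
apply: contraNneq P1 => r0; rewrite PQ derivM derivX mulr1 hornerD hornerM hornerX mulr0 add0r.
by rewrite -rootE -r0.
Qed.

Lemma horner_midpoint (H : {poly C}) (k : R) (x y y' : C) :
  (forall s, root H s -> N (y - s) * N (y' - s) <= k * N (x - s) ^+ 2) ->
  N H.[y] * N H.[y'] <= k ^+ (size H).-1 * N H.[x] ^+ 2.
Proof.
move=> hk; have [->|H0] := eqVneq H 0.
  by rewrite !horner0 normc0 mulr0 expr0n /= mulr0.
have [rs Hrs] := closed_field_poly_normal H.
have lc : lead_coef H != 0 by rewrite lead_coef_eq0.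
have -> : (size H).-1 = size rs by rewrite Hrs size_scale// size_prod_XsubC.
have : forall s, s \in rs -> N (y - s) * N (y' - s) <= k * N (x - s) ^+ 2.
  by move=> s hs; apply: hk; rewrite Hrs rootZ// root_prod_XsubC.
rewrite Hrs !hornerZ !normcM exprMn mulrACA [leRHS]mulrCA -expr2 => h.
apply: ler_wpM2l; first by rewrite sqr_ge0.
elim: rs h {Hrs hk} => [|s rs IH] h.
  by rewrite !big_nil !hornerC expr0 normc1 expr1n !mul1r.
rewrite !big_cons !hornerM !hornerXsubC !normcM (exprS k) [leLHS]mulrACA exprMn [leRHS]mulrACA.
apply: ler_pM; rewrite ?mulr_ge0 ?normc_ge0//; first by apply: h; rewrite mem_head.
by apply: IH => u hu; apply: h; rewrite inE hu orbT.
Qed.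

(** The product [(y - t) (y' - t)] equals the squared distance from [t] to the midpoint minus the
    squared half-length; it is nonnegative because [t] is not strictly between [y] and [y']. *)
Lemma real_midpoint (c Lc y y' t : R) : 0 <= c -> y + 2 * c <= y' -> 0 < Lc ->
  `|(y + y') / 2 - t| <= Lc -> ~ (y <= t <= y') ->
  `|y - t| * `|y' - t| <= (1 - (c / Lc) ^+ 2) * `|(y + y') / 2 - t| ^+ 2.
Proof.
move=> c0 yy Lc0 xt ht.
have hpos : 0 <= (y - t) * (y' - t).
  have [ty|ty] := ltP t y; first by apply: mulr_ge0; lra.
  have [ty'|ty'] := leP t y'; first by case: ht; rewrite ty.
  by apply: mulr_le0; lra.
rewrite -normrM ger0_norm// [leRHS]mulrBl mul1r.
have -> : (y - t) * (y' - t) = ((y + y') / 2 - t) ^+ 2 - ((y' - y) / 2) ^+ 2 by field.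
rewrite real_normK ?num_real// lerD2l lerN2.
apply: le_trans (_ : c ^+ 2 <= _).
  rewrite -exprMn -[leRHS]real_normK ?num_real// -[leLHS]real_normK ?num_real//.
  rewrite ler_sqr ?nnegrE// normrM normrM normfV (gtr0_norm Lc0) mulrAC ler_pdivrMr//.
  by rewrite ler_wpM2l.
by rewrite ler_sqr ?nnegrE//; lra.
Qed.

(* On an interval free of roots of a real-rooted [H] of degree [m], the second
   derivative of [log |H|] is at most [- m / Lc ^ 2]. *)
Lemma horner_log_concave (H : {poly C}) (c Lc y y' : R) :
  0 <= c -> y + 2 * c <= y' -> 0 < Lc ->
  (forall v, root H v -> exists2 t, v = of_real t &
     `|(y + y') / 2 - t| <= Lc /\ ~ (y <= t <= y')) ->
  N H.[of_real y] * N H.[of_real y'] <=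
  (1 - (c / Lc) ^+ 2) ^+ (size H).-1 * N H.[of_real ((y + y') / 2)] ^+ 2.
Proof.
move=> c0 yy Lc0 hr; apply: horner_midpoint => v /hr [t -> [xt ht]].
rewrite /of_real -!rmorphB !normc_of_real; exact: real_midpoint.
Qed.

End Growth.

(** * Zeros of the Poincare function, preimages of zero and the Julia set *)

Section Preimages.
Variables (R : realType) (p : {poly R}) (lambda : R) (f : cplx R -> cplx R).
Local Notation C := (cplx R).
Local Notation N := (@normc R).
Local Notation L := (of_real lambda).
Local Notation P := (cpoly p).
Hypothesis sp : (2 < size p)%N.
Hypothesis p0 : p.[0] = 0.
Hypothesis p1 : (deriv p).[0] = lambda.
Hypothesis lambda1 : 1 < lambda.
Hypothesis hf : entire f.
Hypothesis hfP : forall z, f (L * z) = P.[f z].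
Hypothesis f0 : f 0 = 0.
Hypothesis f1 : derive1 f 0 = 1.

Lemma horner_cpoly (q : {poly R}) x : (cpoly q).[of_real x] = of_real q.[x].
Proof. exact: (horner_map (real_complex R)). Qed.

Lemma iter_cpoly n x : iter n (horner P) (of_real x) = of_real (iter n (horner p) x).
Proof. by elim: n => //= n ->; rewrite horner_cpoly. Qed.

Lemma cpoly_root0 : P.[0] = 0.
Proof. by have := horner_cpoly p 0; rewrite p0. Qed.

Lemma cpoly_multiplier : P^`().[0] = L.
Proof. by rewrite /cpoly (deriv_map (real_complex R)) -p1; exact: horner_cpoly. Qed.

Lemma size_cpoly : size P = size p.
Proof. exact: (size_map_poly (real_complex R)). Qed.

Let sP : (2 < size P)%N. Proof. by rewrite size_cpoly. Qed.
Let P0 := cpoly_root0.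
Let P1 := cpoly_multiplier.

(** If [w] is omitted, so is any [w1] with [P w1 = w]. Then [w1 = w], so [w] is fixed by [P] and
    equals its iterate [0], a value of [f]. *)
Lemma preimage0_in_range n w : iter n (horner P) w = 0 -> exists z, f z = w.
Proof.
move=> hn; apply: contrapT => hw.
have hw0 z : f z != w by apply/eqP => h; apply: hw; exists z.
have /closed_rootP [w1 hw1] : size (P - w%:P) != 1%N.
  rewrite size_polyDl; first by case: (size P) sP => [|[]].
  by rewrite size_polyN (leq_ltn_trans (size_polyC_leq1 _))// (ltn_trans _ sP).
have {}hw1 : P.[w1] = w.
  by move: hw1; rewrite rootE hornerD hornerN hornerC subr_eq0 => /eqP.
have hw2 z : f z != w1.
  by apply: contraNneq (hw0 (L * z)) => h; rewrite hfP h hw1.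
have ww := poincare_omits_at_most_one lambda1 sP P0 P1 hf hfP f0 f1 hw0 hw2.
have it k : iter k (horner P) w = w by elim: k => //= k ->; rewrite {1}ww.
by have := hw0 0; rewrite f0 -hn it eqxx.
Qed.

Lemma poincare_zero_limit z e : f z = 0 -> 0 < e ->
  exists n w, iter n (horner P) w = 0 /\ N (of_real (lambda ^+ n) * w - z) < e.
Proof.
move=> fz e0; have l1 := lambda1.
have z0 := normc_ge0 z.
have e1 : 0 < e / (N z + 1) by rewrite divr_gt0//; lra.
have [r r0 hr] := entire_deriv0 hf f0 f1 e1.
have [n hn] := expr_unbounded (N z / r) l1.
have {}hn := hn n (leqnn _).
have ln0 : 0 < lambda ^+ n by rewrite exprn_gt0//; lra.
exists n, (f (z / L ^+ n)).
have zE : L ^+ n * (z / L ^+ n) = z by rewrite mulrC divfK// multiplier_expn_neq0.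
rewrite -(poincare_iter hfP) zE; split => //.
have -> : of_real (lambda ^+ n) = L ^+ n by rewrite /of_real rmorphXn.
rewrite -{2}zE -mulrBr normcM normc_multiplier_expn//.
have Nz : N (z / L ^+ n) = N z / lambda ^+ n by rewrite normcM normcV normc_multiplier_expn.
have := hr (z / L ^+ n); rewrite Nz ltr_pdivrMr// mulrC -ltr_pdivrMr// => /(_ hn) h.
apply: le_lt_trans (_ : lambda ^+ n * (e / (N z + 1) * (N z / lambda ^+ n)) < e).
  by rewrite ler_pM2l.
have -> : lambda ^+ n * (e / (N z + 1) * (N z / lambda ^+ n)) = e * (N z / (N z + 1)).
  by field; rewrite !gt_eqF//; lra.
by rewrite gtr_pMr// ltr_pdivrMr; lra.
Qed.

Lemma julia_zeros_real : julia_set P `<=` real_line R ->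
  forall z, f z = 0 -> real_line R z.
Proof.
move=> hJ z fz; suff : complex.Im (z : R[i]) = 0.
  by case: z {fz} => a b /= ->; exists a.
apply/eqP; rewrite -normr_eq0; apply/eqP/le_anti; rewrite normr_ge0 andbT.
apply/ler_addgt0Pr => e e0; rewrite add0r.
have [n [w [hw hN]]] := poincare_zero_limit fz e0.
have [x _ xw] : real_line R w.
  apply: hJ; apply: (preimage0_julia P0 _ hw).
  by rewrite P1 normc_of_real gtr0_norm//; apply: lt_trans lambda1.
apply: le_trans (ltW hN); apply: le_trans (Im_le_normc _).
rewrite -xw /of_real -rmorphM; case: (z) => a b /=.
by rewrite add0r normrN.
Qed.

Lemma julia_zeros_nonpos : julia_set P `<=` neg_reals R `|` [set 0] ->
  forall z, f z = 0 -> nonpos_reals R z.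
Proof.
move=> hJ z fz.
have hJ' w : julia_set P w -> exists2 x, x <= 0 & w = of_real x.
  by move=> /hJ [[x /= x0 <-]|->]; [exists x => //; exact: ltW|exists 0].
have [|x _ xz] := julia_zeros_real _ fz; first by move=> w /hJ' [x _ ->]; exists x.
exists x => //=; apply/ler_addgt0Pr => e e0; rewrite add0r.
have [n [w [hw hN]]] := poincare_zero_limit fz e0.
have [y y0 yw] : exists2 x, x <= 0 & w = of_real x.
  apply: hJ'; apply: (preimage0_julia P0 _ hw).
  by rewrite P1 normc_of_real gtr0_norm//; apply: lt_trans lambda1.
move: hN; rewrite yw -xz /of_real -rmorphM -rmorphB normc_of_real ltr_norml => /andP[h _].
have ln0 : 0 < lambda ^+ n by rewrite exprn_gt0// (lt_trans _ lambda1).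
have : lambda ^+ n * y <= 0 by rewrite pmulr_rle0.
lra.
Qed.

(** If [w = f z], then [lambda^n z] is a zero of [f]; so [z] is real, and [f] is real on the real
    line. *)
Lemma preimage0_real : (forall z, f z = 0 -> real_line R z) ->
  forall n w, iter n (horner P) w = 0 -> real_line R w.
Proof.
move=> hz n w hw; have [z fz] := preimage0_in_range hw.
have [x _ hx] : real_line R (L ^+ n * z) by apply: hz; rewrite (poincare_iter hfP) fz.
have zx : z = of_real (x / lambda ^+ n).
  apply: (mulfI (multiplier_expn_neq0 lambda1 n)); rewrite -hx /of_real -rmorphXn -rmorphM.
  by rewrite mulrC divfK// gt_eqF// exprn_gt0// (lt_trans _ lambda1).
have [|y hy] := poincare_real lambda1 P0 P1 hf hfP f0 f1 _ (x / lambda ^+ n).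
  by move=> t; exists p.[t]; exact: horner_cpoly.
by exists y; rewrite // -fz zx hy.
Qed.

(** The two targets are [0] and a nonzero root [r] of [P], whose preimages reach [0] one step
    later. *)
Lemma julia_sub_interval a b : a <= b ->
  (forall n w, iter n (horner P) w = 0 -> exists2 x, a <= x <= b & w = of_real x) ->
  forall w, julia_set P w -> exists2 x, a <= x <= b & w = of_real x.
Proof.
move=> ab hpre w hJ; apply: contrapT => hw; apply: hJ.
have [|r r0 Pr] := preimage0_neq0 sP P0.
  by rewrite P1; have := multiplier_expn_neq0 lambda1 1; rewrite expr1.
apply: (@real_preimages_fatou R P a b 0 r) => //; first by rewrite eq_sym.
move=> n v [|hv]; first exact: hpre.
by apply: (hpre n.+1); rewrite iterS hv.
Qed.

Lemma zeros_julia_real : (forall z, f z = 0 -> real_line R z) ->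
  julia_set P `<=` real_line R.
Proof.
move=> hz; have [M M0 hM] := preimages0_bounded sP P0.
have MM : - M <= M by have m0 := M0; lra.
move=> w /(julia_sub_interval MM) [|x _ ->]; last by exists x.
move=> n v hv; have [x _ xv] := preimage0_real hz hv.
exists x => //; rewrite -ler_norml -normc_of_real xv; exact: hM hv.
Qed.

(* [log p^n] and [log (w - p^n)] are strongly concave on the interval for large
   [n], so neither function can stay above [w / 2] at two distant points; yet
   their sum is [w]. *)
Lemma no_bounded_interval (s w : R) : 0 < s -> 0 < w ->
  (forall n v, iter n (horner P) v = 0 -> real_line R v) ->
  (exists n, iter n (horner P) (of_real w) = 0) ->
  ~ (forall n x, 0 < x < s -> 0 < iter n (horner p) x < w).
Proof.
move=> s0 w0 hreal [nw hw] hint.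
have [M M0 hM] := preimages0_bounded sP P0.
(* Midpoints lie in [(0, s)] and preimages of [0] have modulus at most [M], so [Lc] bounds their
   distances. The points used below are at least [s / 4] apart, twice [s / 8]. *)
pose Lc := M + s; have Lc0 : 0 < Lc by rewrite addr_gt0.
have q0 : 0 < s / 8 / Lc by rewrite !divr_gt0.
have q1 : s / 8 / Lc < 1 by rewrite ltr_pdivrMr// mul1r /Lc; lra.
pose k := 1 - (s / 8 / Lc) ^+ 2.
have k0 : 0 < k by rewrite subr_gt0 expr_lt1// ltW.
have k1 : k < 1 by rewrite ltrBlDr ltrDl exprn_gt0.
(* The bound [1 / 4] is the ratio of [(w / 2) ^+ 2] to [w ^+ 2]: endpoint values at least [w / 2]
   then clash with a midpoint value below [w]. *)
have [n hn] : exists n, forall m, (n <= m)%N -> k ^+ m < 1 / 4.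
  have k1' : 1 < k^-1 by rewrite invf_gt1.
  have [n hn] := expr_unbounded 4 k1'.
  exists n => m /hn; rewrite exprVn mul1r.
  by rewrite -[X in X < _]invrK ltf_pV2 ?posrE ?invr_gt0 ?exprn_gt0.
pose Q := poly_iter P n.
have sQ : (n < (size Q).-1)%N.
  by rewrite size_poly_iter; apply: ltn_expl; move: sP; case: (size P) => [|[]].
have Qx x : Q.[of_real x] = of_real (iter n (horner p) x).
  by rewrite horner_poly_iter iter_cpoly.
have key (H : {poly C}) (y y' : R) : (size H).-1 = (size Q).-1 ->
    (forall v, root H v -> exists m, iter m (horner P) v = 0) ->
    (forall x, 0 < x < s -> 0 < N H.[of_real x] < w) ->
    0 < y -> y + 2 * (s / 8) <= y' -> y' < s ->
    w / 2 <= N H.[of_real y] -> w / 2 <= N H.[of_real y'] -> False.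
  move=> sH Hpre Hint y0 yy y's hy hy'.
  have xint : 0 < (y + y') / 2 < s by apply/andP; split; lra.
  have := @horner_log_concave R H (s / 8) Lc y y' (ltW (divr_gt0 s0 (ltr0n _ 8))) yy Lc0.
  rewrite -/k sH => h; have {}h := h _.
  have /andP[h1 h2] := Hint _ xint.
  set x := (y + y') / 2 in xint h1 h2 h.
  have h3 : (w / 2) * (w / 2) <= N H.[of_real y] * N H.[of_real y'].
    by apply: ler_pM; rewrite // divr_ge0// ltW.
  have h4 : N H.[of_real x] ^+ 2 <= w ^+ 2 by rewrite ler_sqr ?nnegrE ?normc_ge0 ?ltW.
  have h6 : k ^+ (size Q).-1 * N H.[of_real x] ^+ 2 <= k ^+ (size Q).-1 * w ^+ 2.
    by rewrite ler_wpM2l// exprn_ge0// ltW.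
  have h7 : k ^+ (size Q).-1 * w ^+ 2 < 1 / 4 * w ^+ 2.
    by rewrite ltr_pM2r ?exprn_gt0//; apply: hn; exact: ltnW.
  have h8 : w / 2 * (w / 2) = 1 / 4 * w ^+ 2 by field.
  have := le_lt_trans h6 h7; rewrite -h8 ltNge => /negP; apply.
  apply: le_trans h3 (h _) => v hv.
  have [m hm] := Hpre v hv; have [t _ tv] := hreal m v hm.
  have tM : `|t| <= M by rewrite -normc_of_real tv; exact: hM hm.
  exists t => //; split.
    apply: le_trans (ler_normB _ _) _; rewrite /Lc addrC lerD// ger0_norm.
      by have /andP[_ /ltW] := xint.
    by have /andP[/ltW] := xint.
  move=> /andP[ty ty']; have := Hint t; rewrite tv (rootP hv) normc0 ltxx /=.
  suff -> : 0 < t < s by move=> /(_ isT).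
  by rewrite (lt_le_trans y0 ty) (le_lt_trans ty' y's).
pose Qw := Q - (of_real w)%:P.
have sQw : (size Qw).-1 = (size Q).-1.
  rewrite size_polyDl// size_polyN (leq_ltn_trans (size_polyC_leq1 _))//.
  by case: (size Q) sQ => [|[]].
have NQ x : 0 < x < s -> N Q.[of_real x] = iter n (horner p) x.
  by move=> hx; rewrite Qx normc_of_real gtr0_norm//; have /andP[] := hint n x hx.
have NQw x : 0 < x < s -> N Qw.[of_real x] = w - iter n (horner p) x.
  move=> hx; rewrite hornerD hornerN hornerC Qx /of_real -rmorphB normc_of_real.
  by rewrite ltr0_norm ?opprB// subr_lt0; have /andP[] := hint n x hx.
have keyQ y y' := key Q y y' erefl.
have keyQw y y' := key Qw y y' sQw.
have {}keyQ y y' : 0 < y -> y + 2 * (s / 8) <= y' -> y' < s ->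
    w / 2 <= N Q.[of_real y] -> w / 2 <= N Q.[of_real y'] -> False.
  apply: keyQ => [v hv|x hx]; first by exists n; rewrite -horner_poly_iter (rootP hv).
  by rewrite NQ//; exact: hint.
have {}keyQw y y' : 0 < y -> y + 2 * (s / 8) <= y' -> y' < s ->
    w / 2 <= N Qw.[of_real y] -> w / 2 <= N Qw.[of_real y'] -> False.
  apply: keyQw => [v hv|x hx].
    (* A root of [Qw] reaches [w] in [n] steps and [0] after [nw] more. *)
    have E : iter n (horner P) v = of_real w.
      have /eqP := rootP hv; rewrite hornerD hornerN hornerC subr_eq0.
      by rewrite horner_poly_iter => /eqP.
    by exists (nw + n)%N; rewrite iterD E.
  by rewrite NQw// ltrBlDr ltrDl subr_gt0 andbC; exact: hint.
have dich x : 0 < x < s -> w / 2 <= N Q.[of_real x] \/ w / 2 <= N Qw.[of_real x].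
  move=> hx; rewrite NQ// NQw//; have [h|/ltW h] := lerP (w / 2) (iter n (horner p) x).
    by left.
  by right; rewrite lerBrDr -lerBrDl [leRHS](_ : _ = w / 2)//; field.
have i1 : 0 < 1 / 4 * s < s by apply/andP; split; lra.
have i2 : 0 < 2 / 4 * s < s by apply/andP; split; lra.
have i3 : 0 < 3 / 4 * s < s by apply/andP; split; lra.
have /andP[l1 _] := i1; have /andP[l2 g2] := i2; have /andP[_ g3] := i3.
have d12 : 1 / 4 * s + 2 * (s / 8) <= 2 / 4 * s by lra.
have d23 : 2 / 4 * s + 2 * (s / 8) <= 3 / 4 * s by lra.
have d13 : 1 / 4 * s + 2 * (s / 8) <= 3 / 4 * s by lra.
(* Among three points, two fall under the same alternative. *)
have [a1|a1] := dich _ i1; have [a2|a2] := dich _ i2; have [a3|a3] := dich _ i3.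
- exact: keyQ l1 d12 g2 a1 a2.
- exact: keyQ l1 d12 g2 a1 a2.
- exact: keyQ l1 d13 g3 a1 a3.
- exact: keyQw l2 d23 g3 a2 a3.
- exact: keyQ l2 d23 g3 a2 a3.
- exact: keyQw l1 d13 g3 a1 a3.
- exact: keyQw l1 d12 g2 a1 a2.
- exact: keyQw l1 d12 g2 a1 a2.
Qed.

(** On the positive axis [f] takes neither the value [0] nor [w], since either would yield a
    positive zero [lambda^n t]. Intermediate values confine it to [(0, w)], and the functional
    equation confines the iterates on [(0, f 1)]. *)
Lemma preimage0_nonpos : (forall z, f z = 0 -> nonpos_reals R z) ->
  forall n (w : R), iter n (horner P) (of_real w) = 0 -> w <= 0.
Proof.
move=> hz nw w hw; rewrite leNgt; apply/negP => w0.
have hzr z : f z = 0 -> real_line R z by move=> /hz [x _ <-]; exists x.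
have hreal := preimage0_real hzr.
have /choice [phi hphi] : forall t : R, exists y : R, f (of_real t) = of_real y.
  by apply: (poincare_real lambda1 P0 P1 hf hfP f0 f1) => x; exists p.[x]; exact: horner_cpoly.
have dist_phi t u : N (f (of_real t) - f (of_real u)) = `|phi t - phi u|.
  by rewrite !hphi /of_real -rmorphB normc_of_real.
have phi_cont : continuous phi.
  move=> t; apply/cvgrPdist_lt => e e0.
  have [r r0 hr] := entire_continuous hf (of_real t) e0.
  near=> u; rewrite distrC -dist_phi; apply: hr.
  rewrite /of_real -rmorphB normc_of_real distrC.
  by near: u; apply: cvgr_dist_lt.
have phi0 : phi 0 = 0.
  by apply: (@complexI R); have := hphi 0; rewrite [of_real 0]/(0 : C) f0.
have no_zero n t : 0 < t -> iter n (horner P) (f (of_real t)) <> 0.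
  move=> t0; rewrite -(poincare_iter hfP) => /hz [x /= x0 hx].
  have : x = lambda ^+ n * t.
    by apply: (@complexI R); rewrite rmorphM rmorphXn; exact: hx.
  move=> xE; move: x0; rewrite xE leNgt mulr_gt0// exprn_gt0//.
  exact: lt_trans lambda1.
have phi_neq0 t : 0 < t -> phi t <> 0.
  by move=> t0 h; apply: (no_zero 0%N _ t0); rewrite /= hphi h.
have phi_neqw t : 0 < t -> phi t <> w.
  by move=> t0 h; apply: (no_zero nw _ t0); rewrite hphi h.
have IVTphi a b v : a <= b -> Num.min (phi a) (phi b) <= v <= Num.max (phi a) (phi b) ->
    exists2 c, a <= c <= b & phi c = v.
  move=> ab h; have [|c] := IVT ab _ h; first exact: continuous_subspaceT.
  by rewrite in_itv /= => cab <-; exists c.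
have phi_pos t : 0 < t -> 0 < phi t.
  move=> t0; rewrite ltNge; apply/negP => pt.
  have half0 : 0 < 1 / 2 :> R by lra.
  (* Tangency to the identity gives [phi u >= u / 2] for small positive [u]. *)
  have [e e0 he] := entire_deriv0 hf f0 f1 half0.
  pose u := Num.min t (e / 2).
  have u0 : 0 < u by rewrite lt_min t0 divr_gt0.
  have ut : u <= t by rewrite ge_min lexx.
  have ue : u < e.
    by apply: le_lt_trans (_ : e / 2 < e); [rewrite ge_min lexx orbT|lra].
  have := he (of_real u); rewrite normc_of_real gtr0_norm// => /(_ ue).
  rewrite hphi /of_real -rmorphB normc_of_real => h.
  have pu : 0 < phi u.
    move: h; rewrite ler_norml => /andP[h _]; lra.
  have [|c /andP[uc _] hc] := IVTphi u t 0 ut.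
    by rewrite ge_min pt orbT le_max (ltW pu).
  exact: phi_neq0 (lt_le_trans u0 uc) hc.
have phi_ltw t : 0 < t -> phi t < w.
  move=> t0; rewrite ltNge; apply/negP => pt.
  have [|c /andP[c0 _] hc] := IVTphi 0 t w (ltW t0).
    by rewrite phi0 ge_min (ltW w0) /= le_max pt orbT.
  apply: phi_neqw (hc); rewrite lt_neqAle c0 andbT; apply/eqP => c0'.
  by move: hc; rewrite -c0' phi0 => h; rewrite h ltxx in w0.
apply: (@no_bounded_interval (phi 1) w (phi_pos _ ltr01) w0 hreal); first by exists nw.
move=> n x /andP[x0 x1].
(* Writing [x = phi t] turns the iterate at [x] into [phi (lambda ^+ n * t)]. *)
have [|t /andP[t0 _] ht] := IVTphi 0 1 x ler01.
  by rewrite phi0 ge_min (ltW x0) /= le_max (ltW x1) orbT.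
have {}t0 : 0 < t.
  rewrite lt_neqAle t0 andbT; apply/eqP => t0'.
  by move: x0; rewrite -ht -t0' phi0 ltxx.
have -> : iter n (horner p) x = phi (lambda ^+ n * t).
  apply: (@complexI R); rewrite -[LHS]iter_cpoly -[RHS]hphi -ht -hphi -(poincare_iter hfP).
  by congr (f _); rewrite /of_real rmorphM rmorphXn.
have lt0 : 0 < lambda ^+ n * t by rewrite mulr_gt0// exprn_gt0// (lt_trans _ lambda1).
by rewrite phi_pos// phi_ltw.
Unshelve. all: by end_near.
Qed.

Lemma zeros_julia_nonpos : (forall z, f z = 0 -> nonpos_reals R z) ->
  julia_set P `<=` neg_reals R `|` [set 0].
Proof.
move=> hz; have [M M0 hM] := preimages0_bounded sP P0.
have hzr z : f z = 0 -> real_line R z by move=> /hz [x _ <-]; exists x.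
have MM : - M <= 0 by rewrite oppr_le0 ltW.
move=> w /(julia_sub_interval MM) [|x /andP[_ x0] ->].
  move=> n v hv; have [x _ xv] := preimage0_real hzr hv.
  exists x => //; have xM : `|x| <= M by rewrite -normc_of_real xv; exact: hM hv.
  have /andP[-> _] : - M <= x <= M by rewrite -ler_norml.
  by apply: (preimage0_nonpos hz (n := n)); rewrite xv.
have [->|xn0] := eqVneq x 0; first by right.
by left; exists x => //=; rewrite lt_neqAle xn0.
Qed.

End Preimages.

Theorem theorem3p2 (R : realType) (d : nat) (p : {poly R}) (lambda : R)
    (f : cplx R -> cplx R)
    (hd : (2 <= d)%N) (hdeg : size p = d.+1)
    (hp0 : p.[0] = 0) (hp1 : (deriv p).[0] = lambda) (hlambda : 1 < lambda)
    (hf : entire f)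
    (hfp : forall z : cplx R, f (of_real lambda * z) = (cpoly p).[f z])
    (hf0 : f 0 = 0) (hf1 : derive1 f 0 = 1) :
  (julia_set (cpoly p) `<=` neg_reals R `|` [set 0] <->
   (forall z : cplx R, f z = 0 -> nonpos_reals R z)) /\
  (julia_set (cpoly p) `<=` real_line R <->
   (forall z : cplx R, f z = 0 -> real_line R z)).
Proof.
have sp : (2 < size p)%N by rewrite hdeg.
split; split => h.
- exact: (julia_zeros_nonpos hp0 hp1 hlambda hf hfp hf0 hf1 h).
- exact: (zeros_julia_nonpos sp hp0 hp1 hlambda hf hfp hf0 hf1 h).
- exact: (julia_zeros_real hp0 hp1 hlambda hf hfp hf0 hf1 h).
- exact: (zeros_julia_real sp hp0 hp1 hlambda hf hfp hf0 hf1 h).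
Qed.
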